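(* Let $n\ge 2$, let $U_1,\dots,U_n$ be bounded domains in the complex plane, and let $G=U_1\times\dots\times U_n$ be their cartesian product. Let $V\subset\mathbb{C}$ be a bounded domain and let $f:G\to\Sigma^nV$ be a proper holomorphic map. Then there are proper holomorphic maps $g_j:U_j\to V$, $j=1,\dots,n$, such that $$f=\pi\circ(g_1\times\dots\times g_n),$$ where, for $z=(z_1,\dots,z_n)\in G$, $(g_1\times\dots\times g_n)(z)=(g_1(z_1),\dots,g_n(z_n))$.
   Context: Let $\pi=(\pi_1,\dots,\pi_n):\mathbb{C}^n\to\mathbb{C}^n$ be the symmetrization map, where $\pi_k(z)=\sum_{J\subset\{1,\dots,n\},\,|J|=k}\prod_{j\in J}z_j$ is the $k$-th elementary symmetric polynomial in $n$ variables. For a domain $V\subset\mathbb{C}$, $\Sigma^nV=\pi(V^n)$, which is a domain in $\mathbb{C}^n$. *)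

(* Defs.v *)
From HB Require Import structures.
From mathcomp Require Import all_boot all_order all_algebra.
From mathcomp Require Import all_classical all_reals all_analysis.
From mathcomp Require Import complex.

Set Implicit Arguments.
Unset Strict Implicit.
Unset Printing Implicit Defensive.

Import Order.TTheory GRing.Theory Num.Theory.
Import numFieldNormedType.Exports.

Local Open Scope classical_set_scope.
Local Open Scope ring_scope.

(* No topology is inferred on the bare type R[i]; as a numClosedFieldType it
   gets the norm topology and is a normed module over itself. *)
Definition Cplx (R : realType) : numClosedFieldType := R[i]%C.

Definition domain (T : topologicalType) (D : set T) : Prop :=
  [/\ D !=set0, open D & connected D].

(* Meant for D open. The scalars are K, so for K = Cplx R the Frechet
   differential is C-linear. *)
Definition holomorphic (K : numFieldType) (V W : normedModType K)
    (D : set V) (f : V -> W) : Prop :=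
  forall z, D z -> differentiable f z.

(* Maps between sets are total functions between the ambient spaces; only
   their values on D matter. Compactness of a subset is intrinsic, so it may
   be tested in the ambient spaces. *)
Definition proper_holomorphic (K : numFieldType) (V W : normedModType K)
    (D : set V) (E : set W) (f : V -> W) : Prop :=
  [/\ set_fun D E f, holomorphic D f &
      forall A : set W, A `<=` E -> compact A -> compact (D `&` f @^-1` A)].

(* Coordinates are numbered from 0, so coordinate k is the elementary
   symmetric polynomial of degree k.+1. *)
Definition symmetrization (K : comNzRingType) (n : nat) (z : 'rV[K]_n) :
    'rV[K]_n :=
  \row_(k < n) \sum_(J : {set 'I_n} | #|J| == k.+1) \prod_(j in J) z ord0 j.

Definition polydomain (K : Type) (n : nat) (U : 'I_n -> set K) :
    set 'rV[K]_n :=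
  [set z | forall j, U j (z ord0 j)].

Definition symmetrized_power (K : comNzRingType) (n : nat) (V : set K) :
    set 'rV[K]_n :=
  @symmetrization K n @` polydomain (fun=> V).

Arguments symmetrized_power {K} n V.

Definition prod_map (K : Type) (n : nat) (g : 'I_n -> K -> K) (z : 'rV[K]_n) :
    'rV[K]_n :=
  \row_(j < n) g j (z ord0 j).

(* Main.v *)
Require Import Defs.
From mathcomp Require Import all_boot all_order all_algebra.
From mathcomp Require Import all_classical all_reals all_analysis.
From mathcomp Require Import complex.
From mathcomp Require Import ring lra zify.
Import numFieldNormedType.Exports.
Import Order.TTheory GRing.Theory Num.Theory.
Local Open Scope classical_set_scope.
Local Open Scope ring_scope.

(* Let P_z be the monic polynomial whose roots are the n points of V whose
   elementary symmetric functions are f(z). When z_j tends to the boundary of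
   U_j along an ultrafilter, properness makes a root of P_z tend to some v
   outside V; since P_z(v) never vanishes, Hurwitz's theorem in the other
   variables gives P_z(v) -> 0 whatever the other coordinates are. Hence the
   resultant of P_z and P_z', where z and z' share their j-th coordinate x,
   tends to 0 at the boundary of U_j, and vanishes by the maximum principle;
   so for each x all the P_z with z_j = x have a common root. Dividing first by
   the greatest common divisor of all the P_z, one finds a point where the
   common roots attached to the n coordinates are distinct; they are then all
   the roots of P_z, and the identity theorem spreads this factorization.

   The required facts about holomorphic functions of one variable are derived
   from Goursat's argument, with limits of trapezoid sums instead of integrals:
   it yields |f(p)| <= 2 max |f| on an annulus around p, and applying this to
   powers of f removes the factor 2. *)

(** * The complex plane *)

(** At the outset the points of V lying over f(z) admit no holomorphic, or even continuous, choice
    in z: only the coefficients of P_z are holomorphic. Roots are therefore followed through limits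
    along ultrafilters, where bounded families converge without any continuity, and through
    identities between coefficients. The resultant detects a common root without naming it, but it
    compares only two polynomials; the passage to all of them combines the finitely many roots of a
    single one with the absence of zero divisors among holomorphic functions on a connected open
    set. The greatest common divisor has to be removed because the n common roots could otherwise
    all be the same constant. Its own roots lie in V, so dividing by it preserves the decay at a
    point v outside V. Afterwards no fixed value is a root of all quotients, and the common root
    attached to a further coordinate can be moved off the earlier ones. In the end n distinct roots
    exhaust the degree, which shows that the divisor was constant. *)

Definition cre (R : realType) (z : Cplx R) : R := complex.Re z.
Definition cim (R : realType) (z : Cplx R) : R := complex.Im z.
Definition mkC (R : realType) (a b : R) : Cplx R := (a +i* b)%C.
Definition cabs (R : realType) (z : Cplx R) : R := cre R `|z|.

Arguments cre {R}.
Arguments cim {R}.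
Arguments mkC {R}.
Arguments cabs {R}.

Lemma mkC_eta (R : realType) (z : Cplx R) : z = mkC (cre z) (cim z).
Proof. by case: z. Qed.

Lemma creD (R : realType) (x y : Cplx R) : cre (x + y) = cre x + cre y.
Proof. by case: x; case: y. Qed.

Lemma cimD (R : realType) (x y : Cplx R) : cim (x + y) = cim x + cim y.
Proof. by case: x; case: y. Qed.

Lemma creN (R : realType) (x : Cplx R) : cre (- x) = - cre x.
Proof. by case: x. Qed.

Lemma cimN (R : realType) (x : Cplx R) : cim (- x) = - cim x.
Proof. by case: x. Qed.

Lemma creM (R : realType) (x y : Cplx R) :
  cre (x * y) = cre x * cre y - cim x * cim y.
Proof. by case: x; case: y. Qed.

Lemma cimM (R : realType) (x y : Cplx R) :
  cim (x * y) = cre x * cim y + cim x * cre y.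
Proof. by case: x; case: y. Qed.

Lemma normC_cabs (R : realType) (z : Cplx R) : `|z| = mkC (cabs z) 0.
Proof. by rewrite /cabs /cre /mkC normc_def. Qed.

Lemma cabsE (R : realType) (z : Cplx R) :
  cabs z = Num.sqrt (cre z ^+ 2 + cim z ^+ 2).
Proof. by rewrite /cabs /cre /cim normc_def. Qed.

Lemma sqr_cabs (R : realType) (z : Cplx R) :
  cabs z ^+ 2 = cre z ^+ 2 + cim z ^+ 2.
Proof. by rewrite cabsE sqr_sqrtr // addr_ge0 // sqr_ge0. Qed.

Lemma cabs_ge0 (R : realType) (z : Cplx R) : 0 <= cabs z.
Proof. by rewrite cabsE sqrtr_ge0. Qed.

Lemma cabsM (R : realType) (x y : Cplx R) : cabs (x * y) = cabs x * cabs y.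
Proof.
rewrite !cabsE -sqrtrM ?addr_ge0 ?sqr_ge0 // creM cimM; congr Num.sqrt.
ring.
Qed.

Lemma cabsD (R : realType) (x y : Cplx R) : cabs (x + y) <= cabs x + cabs y.
Proof.
have := ler_normD x y; rewrite !normC_cabs.
by rewrite lecE /= => /andP[_].
Qed.

Lemma cabs0 (R : realType) : cabs (0 : Cplx R) = 0.
Proof. by rewrite /cabs normr0. Qed.

Lemma cabs1 (R : realType) : cabs (1 : Cplx R) = 1.
Proof. by rewrite /cabs normr1. Qed.

Lemma cabs_eq0 (R : realType) (z : Cplx R) : (cabs z == 0) = (z == 0).
Proof.
apply/eqP/eqP => [h|->]; last exact: cabs0.
by apply/normr0_eq0; rewrite normC_cabs h.
Qed.

Lemma cabs_gt0 (R : realType) (z : Cplx R) : (0 < cabs z) = (z != 0).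
Proof. by rewrite lt_def cabs_ge0 andbT cabs_eq0. Qed.

Lemma cabsN (R : realType) (z : Cplx R) : cabs (- z) = cabs z.
Proof. by rewrite /cabs normrN. Qed.

Lemma cabsC (R : realType) (x y : Cplx R) : cabs (x - y) = cabs (y - x).
Proof. by rewrite -cabsN opprB. Qed.

Lemma cabsB (R : realType) (x y : Cplx R) : cabs (x - y) <= cabs x + cabs y.
Proof. by rewrite -[cabs y]cabsN cabsD. Qed.

Lemma cabs_trans (R : realType) (x y z : Cplx R) :
  cabs (x - z) <= cabs (x - y) + cabs (y - z).
Proof.
by apply: le_trans (cabsD _ _ _); rewrite addrA subrK.
Qed.

Lemma cabsV (R : realType) (z : Cplx R) : cabs z^-1 = (cabs z)^-1.
Proof.
have [->|z0] := eqVneq z 0; first by rewrite invr0 cabs0 invr0.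
have cz : cabs z != 0 by rewrite cabs_eq0.
by apply: (mulfI cz); rewrite -cabsM divff // cabs1 divff.
Qed.

Lemma cabsX (R : realType) (z : Cplx R) n : cabs (z ^+ n) = cabs z ^+ n.
Proof. by elim: n => [|n IH]; rewrite ?expr0 ?cabs1 // !exprS cabsM IH. Qed.

Lemma cabs_prod (R : realType) (I : Type) (s : seq I) (P : pred I)
    (F : I -> Cplx R) :
  cabs (\prod_(i <- s | P i) F i) = \prod_(i <- s | P i) cabs (F i).
Proof. by apply: big_morph; [exact: cabsM|exact: cabs1]. Qed.

Lemma cabs_re (R : realType) (z : Cplx R) : `|cre z| <= cabs z.
Proof.
by rewrite -sqrtr_sqr cabsE ler_wsqrtr // lerDl sqr_ge0.
Qed.

Lemma cabs_im (R : realType) (z : Cplx R) : `|cim z| <= cabs z.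
Proof.
by rewrite -sqrtr_sqr cabsE ler_wsqrtr // lerDr sqr_ge0.
Qed.

Lemma cabs_le_reim (R : realType) (z : Cplx R) :
  cabs z <= `|cre z| + `|cim z|.
Proof.
rewrite -(ler_pXn2r (n := 2)) ?nnegrE ?cabs_ge0 ?addr_ge0 //.
rewrite sqr_cabs sqrrD !real_normK ?num_real //.
have : 0 <= `|cre z| * `|cim z| by rewrite mulr_ge0.
lra.
Qed.

Lemma cabs_real (R : realType) (r : R) : cabs (mkC r 0) = `|r|.
Proof. by rewrite cabsE /cre /cim /= expr0n addr0 sqrtr_sqr. Qed.

Lemma ltC0P (R : realType) (e : Cplx R) :
  0 < e -> exists2 r : R, 0 < r & e = mkC r 0.
Proof.
case: e => a b; rewrite ltcE /= => /andP[/eqP -> h]; by exists a.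
Qed.

Lemma nbhsCP (R : realType) (z : Cplx R) (A : set (Cplx R)) :
  nbhs z A <-> exists2 r : R, 0 < r & forall w, cabs (w - z) < r -> A w.
Proof.
split.
  move=> /nbhs_ballP[e /= /ltC0P[r r0 ->] h]; exists r => // w hw.
  by apply: h; rewrite /ball /= distrC normC_cabs ltcE /= eqxx.
move=> [r r0 h]; apply/nbhs_ballP; exists (mkC r 0) => /=.
  by rewrite ltcE /= eqxx.
by move=> w; rewrite /ball /= distrC normC_cabs ltcE /= eqxx => /h.
Qed.

Lemma cvgCP (R : realType) (T : Type) (F : set_system T) (FF : Filter F)
    (f : T -> Cplx R) (l : Cplx R) :
  f @ F --> l <-> forall e : R, 0 < e -> F [set t | cabs (f t - l) < e].
Proof.
split=> [fl e e0|h].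
  by have := fl [set w | cabs (w - l) < e]; apply; apply/nbhsCP; exists e.
move=> A lA; have [r r0 hr] := (nbhsCP _ _ _).1 lA.
apply: filterS (h r r0) => t; exact: hr.
Qed.

Lemma bounded_setC (R : realType) (A : set (Cplx R)) :
  bounded_set A -> exists2 B : R, 0 < B & forall z, A z -> cabs z <= B.
Proof.
move=> [M [Mr h]].
have Mim : cim M = 0.
  by move: Mr; rewrite {1}(mkC_eta _ M) complex_real => /eqP.
have : M < mkC (cre M + 1) 0 by rewrite ltcE /= -/(cim M) Mim eqxx ltrDl ltr01.
move=> /h hM; exists (`|cre M| + 1) => [|z Az]; first by rewrite ltr_wpDl.
have := hM z Az; rewrite /= normC_cabs lecE /= => /andP[_ /le_trans]; apply.
by rewrite lerD2r ler_norm.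
Qed.

(** * Ultrafilters and compactness *)

Lemma ultra_fmap (S T : Type) (F : set_system S) (u : S -> T) :
  UltraFilter F -> UltraFilter (u @ F).
Proof.
move=> FU; split; first exact: fmap_proper_filter.
move=> G GF sG; rewrite predeqE => A; split; last exact: sG.
move=> GA; have [//|FnA] := in_ultra_setVsetC (u @^-1` A) FU.
have GnA : G (~` A) by apply: sG.
by have /filter_ex [? []] : G (A `&` ~` A) by exact: filterI.
Qed.

(** This takes the place of extracting subsequences: one ultrafilter makes all maps with values in
    compact sets converge at once. *)
Lemma ultra_compact_cvg (S : Type) (T : topologicalType) (F : set_system S)
    (u : S -> T) (K : set T) :
  UltraFilter F -> compact K -> F (u @^-1` K) ->
  exists2 l, K l & u @ F --> l.
Proof.
move=> FU; rewrite compact_ultra => /(_ _ (ultra_fmap _ _ F u FU)) h /h.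
by move=> [l [Kl ul]]; exists l.
Qed.

Lemma mkC_continuous (R : realType) :
  continuous (fun xy : R * R => mkC xy.1 xy.2).
Proof.
move=> [x y]; apply/cvgCP => e e0 /=.
have e2 : 0 < e / 2 by rewrite divr_gt0.
exists (ball x (e / 2), ball y (e / 2)).
  by split; exact: nbhsx_ballx.
move=> [a b] /= [].
rewrite /ball /= => xa yb.
apply: le_lt_trans (cabs_le_reim _ _) _.
rewrite creD cimD creN cimN /cre /cim /=.
rewrite [e]splitr ltrD // distrC //.
Qed.

Lemma cabs_continuous (R : realType) (p : Cplx R) :
  continuous (fun z : Cplx R => cabs (z - p)).
Proof.
move=> z; apply/(@cvgrPdist_lt _ _ _ (nbhs z) (nbhs_filter z)) => e e0.
apply/nbhsCP; exists e => // w wz /=.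
apply: le_lt_trans wz.
have h1 := cabs_trans _ z w p; have h2 := cabs_trans _ w z p.
rewrite (cabsC _ z w) in h1.
by rewrite ler_norml; apply/andP; split; lra.
Qed.

Lemma closed_disc (R : realType) (p : Cplx R) (r : R) :
  closed [set z | cabs (z - p) <= r].
Proof.
apply: (@preimage_closed _ _ (fun z => cabs (z - p)) [set x | x <= r]).
  by move=> z _; exact: cabs_continuous.
exact: closed_le.
Qed.

Lemma compact_disc (R : realType) (p : Cplx R) (r : R) :
  compact [set z | cabs (z - p) <= r].
Proof.
pose B := `[cre p - r, cre p + r]%classic `*` `[cim p - r, cim p + r]%classic.
apply: (@subclosed_compact _ _ ((fun xy : R * R => mkC xy.1 xy.2) @` B)).
- exact: closed_disc.
- apply: continuous_compact.
    exact: continuous_subspaceT (@mkC_continuous R).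
  by apply: compact_setX; exact: segment_compact.
- move=> z /= zr; exists (cre z, cim z); last by rewrite -mkC_eta.
  have := le_trans (cabs_re _ (z - p)) zr; have := le_trans (cabs_im _ (z - p)) zr.
  rewrite creD cimD creN cimN !ler_norml => /andP[h1 h2] /andP[h3 h4].
  by split=> /=; rewrite in_itv /=; apply/andP; split; lra.
Qed.

(** The scalars are complex, so the derivative in the direction [1] is the complex derivative. *)
Definition hol (R : realType) (f : Cplx R -> Cplx R) (z : Cplx R) : Prop :=
  derivable f z 1.

Arguments hol {R}.

Lemma holE (R : realType) (f : Cplx R -> Cplx R) (z : Cplx R) :
  hol f z <-> derivable f z 1.
Proof. by []. Qed.

(** Clearing the denominator gives an estimate that also makes sense at [w = z], as the bounds on
    whole squares require. *)
Lemma holP (R : realType) (f : Cplx R -> Cplx R) (z : Cplx R) :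
  hol f z <->
  exists L, forall e : R, 0 < e -> exists2 d : R, 0 < d &
    forall w, cabs (w - z) < d ->
      cabs (f w - f z - L * (w - z)) <= e * cabs (w - z).
Proof.
split.
  move=> /cvg_ex[L] /cvgCP fL; exists L => e e0.
  have := fL e e0; rewrite /dnbhs /within /= => /nbhsCP[d d0 h].
  exists d => // w wz.
  have [->|wz0] := eqVneq w z; first by rewrite !subrr mulr0 subr0 cabs0 mulr0.
  have wz1 : w - z != 0 by rewrite subr_eq0.
  have := h (w - z); rewrite subr0 => /(_ wz wz1) /ltW.
  rewrite /= [_ *: 1]mulr1 subrK => /(ler_wpM2r (cabs_ge0 _ (w - z))).
  rewrite -cabsM mulrBl [X in X * _ - _]mulrC mulfVK //.
move=> [L h]; apply/cvg_ex; exists L; apply/cvgCP => e e0.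
have e2 : 0 < e / 2 by rewrite divr_gt0.
have [d d0 hd] := h _ e2.
rewrite /dnbhs /within /=; apply/nbhsCP; exists d => // w; rewrite subr0 => wd w0.
rewrite /= [_ *: 1]mulr1.
have := hd (w + z); rewrite addrK => /(_ wd) h1.
have cw : 0 < cabs w by rewrite cabs_gt0.
rewrite -(ltr_pM2r cw) -cabsM mulrBl [X in X * _ - _]mulrC mulfVK //.
apply: le_lt_trans h1 _; rewrite ltr_pM2r //; lra.
Qed.

Lemma hol_continuous (R : realType) (f : Cplx R -> Cplx R) (z : Cplx R) :
  hol f z -> {for z, continuous f}.
Proof. by move=> /derivable1_diffP; exact: differentiable_continuous. Qed.

Lemma continuousCP (R : realType) (f : Cplx R -> Cplx R) (z : Cplx R) :
  {for z, continuous f} <->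
  forall e : R, 0 < e -> exists2 d : R, 0 < d &
    forall w, cabs (w - z) < d -> cabs (f w - f z) < e.
Proof.
pose cP := cvgCP R _ (nbhs z) (nbhs_filter z) f (f z).
split=> [/cP h e e0|h].
  by have /nbhsCP[d d0 hd] := h e e0; exists d.
by apply/cP => e /h[d d0 hd]; apply/nbhsCP; exists d.
Qed.

(** * Goursat's lemma for trapezoid sums *)

Definition iC (R : realType) : Cplx R := mkC 0 1.

Lemma sqr_iC (R : realType) : iC R * iC R = -1.
Proof.
rewrite /iC (mkC_eta _ (- 1)) (mkC_eta _ (mkC 0 1 * _)) creM cimM /=.
by rewrite /cre /cim /=; congr mkC; ring.
Qed.

Lemma cabs_iC (R : realType) : cabs (iC R) = 1.
Proof. by rewrite cabsE /cre /cim /= expr0n expr1n add0r sqrtr1. Qed.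

Lemma creV (R : realType) (z : Cplx R) : cre z^-1 = cre z / cabs z ^+ 2.
Proof. by rewrite sqr_cabs; case: z. Qed.

Lemma cimV (R : realType) (z : Cplx R) : cim z^-1 = - (cim z / cabs z ^+ 2).
Proof. by rewrite sqr_cabs; case: z. Qed.

Lemma cabs2 (R : realType) : cabs (2 : Cplx R) = 2.
Proof. by rewrite /cabs normr_nat. Qed.

Lemma cre_half (R : realType) (z : Cplx R) : cre (z / 2) = cre z / 2.
Proof.
apply: (@mulfI _ 2) => //; rewrite [in RHS]mulrC divfK //.
have -> : 2 * cre (z / 2) = cre (z / 2 + z / 2) by rewrite creD; ring.
by congr cre; field.
Qed.

Lemma cim_half (R : realType) (z : Cplx R) : cim (z / 2) = cim z / 2.
Proof.
apply: (@mulfI _ 2) => //; rewrite [in RHS]mulrC divfK //.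
have -> : 2 * cim (z / 2) = cim (z / 2 + z / 2) by rewrite cimD; ring.
by congr cim; field.
Qed.

(** Trapezoid sums only ever form midpoints, so their estimates use closure under midpoints
    alone. *)
Definition midconvex (R : realType) (A : set (Cplx R)) : Prop :=
  forall a b, A a -> A b -> A ((a + b) / 2).

Lemma midconvex_disc (R : realType) (M : R) :
  midconvex R [set w | cabs w <= M].
Proof.
move=> a b /= ha hb; rewrite cabsM cabsV cabs2 ler_pdivrMr //.
by apply: le_trans (cabsD _ _ _) _; lra.
Qed.

(* The trapezoid rule on the segment [a, b], refined d times by bisection;
   it plays the role of the integral of h along the segment. *)
Fixpoint amean (R : realType) (h : Cplx R -> Cplx R) (d : nat) (a b : Cplx R)
    : Cplx R :=
  match d with
  | 0 => (h a + h b) / 2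
  | d'.+1 => (amean R h d' a ((a + b) / 2) + amean R h d' ((a + b) / 2) b) / 2
  end.

Arguments amean {R}.

Definition psum (R : realType) (h : Cplx R -> Cplx R) (d : nat)
    (a b : Cplx R) : Cplx R := (b - a) * amean h d a b.

Definition quad (R : realType) (h : Cplx R -> Cplx R) (d : nat)
    (a b c e : Cplx R) : Cplx R :=
  psum R h d a b + psum R h d b c + psum R h d c e + psum R h d e a.

Arguments psum {R}.
Arguments quad {R}.

Lemma amean_in (R : realType) (h : Cplx R -> Cplx R) (A B : set (Cplx R)) :
  midconvex R A -> midconvex R B -> (forall z, A z -> B (h z)) ->
  forall d a b, A a -> A b -> B (amean h d a b).
Proof.
move=> cA cB hAB; elim=> [|d IH] a b Aa Ab /=; apply: cB.
- exact: hAB.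
- exact: hAB.
- by apply: IH => //; exact: cA.
- by apply: IH => //; exact: cA.
Qed.

Lemma amean_lin (R : realType) (f g : Cplx R -> Cplx R) (k : Cplx R) d a b :
  amean (fun z => f z + k * g z) d a b = amean f d a b + k * amean g d a b.
Proof. by elim: d a b => [|d IH] a b /=; rewrite ?IH; field. Qed.

Lemma amean_affine (R : realType) (k l : Cplx R) d a b :
  amean (fun z => k + l * z) d a b = k + l * ((a + b) / 2).
Proof. by elim: d a b => [|d IH] a b /=; rewrite ?IH; field. Qed.

Lemma amean_rev (R : realType) (h : Cplx R -> Cplx R) d a b :
  amean h d a b = amean h d b a.
Proof.
elim: d a b => [|d IH] a b /=; first by rewrite addrC.
by rewrite (IH a) (IH _ b) addrC (addrC a).
Qed.

Lemma psum_rev (R : realType) (h : Cplx R -> Cplx R) d a b :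
  psum h d a b = - psum h d b a.
Proof. by rewrite /psum amean_rev -mulNr opprB. Qed.

Lemma psum_split (R : realType) (h : Cplx R -> Cplx R) d a b m :
  a + b = m + m -> psum h d.+1 a b = psum h d a m + psum h d m b.
Proof.
move=> e; have -> : m = (a + b) / 2 by rewrite e; field.
by rewrite /psum /=; field.
Qed.

(** Each of the four inner edges is traversed twice, in opposite directions, and cancels. *)
Lemma quad_split (R : realType) (h : Cplx R -> Cplx R) d
    (p00 p10 p20 p01 p11 p21 p02 p12 p22 : Cplx R) :
  p00 + p20 = p10 + p10 -> p20 + p22 = p21 + p21 ->
  p22 + p02 = p12 + p12 -> p02 + p00 = p01 + p01 ->
  quad h d.+1 p00 p20 p22 p02 =
    quad h d p00 p10 p11 p01 + quad h d p10 p20 p21 p11 +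
    quad h d p11 p21 p22 p12 + quad h d p01 p11 p12 p02.
Proof.
move=> e1 e2 e3 e4; rewrite /quad.
rewrite (psum_split _ _ _ _ _ p10) // (psum_split _ _ _ _ _ p21) //.
rewrite (psum_split _ _ _ _ _ p12) // (psum_split _ _ _ _ _ p01) //.
rewrite (psum_rev _ _ _ p11 p10) (psum_rev _ _ _ p11 p01).
rewrite (psum_rev _ _ _ p21 p11) (psum_rev _ _ _ p12 p11).
ring.
Qed.

(** The contour sum along the boundary of the square with corner [c] and side vector [s]; the
    multiplication by i turns [s] into the other side. *)
Definition bsum (R : realType) (h : Cplx R -> Cplx R) (d : nat) (c s : Cplx R)
    : Cplx R :=
  quad h d c (c + s) (c + s + iC R * s) (c + iC R * s).

Arguments bsum {R}.

Lemma bsum_split (R : realType) (h : Cplx R -> Cplx R) d (c t : Cplx R) :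
  bsum h d.+1 c (t + t) =
    bsum h d c t + bsum h d (c + t) t + bsum h d (c + t + iC R * t) t +
    bsum h d (c + iC R * t) t.
Proof.
rewrite /bsum (quad_split _ _ _ _ (c + t) _ (c + iC R * t) (c + t + iC R * t)
  (c + t + t + iC R * t) _ (c + t + iC R * t + iC R * t)); try ring.
congr (quad _ _ _ _ _ _ + quad _ _ _ _ _ _ + quad _ _ _ _ _ _ +
       quad _ _ _ _ _ _); ring.
Qed.

Lemma bsum0 (R : realType) (h : Cplx R -> Cplx R) d (c : Cplx R) :
  bsum h d c 0 = 0.
Proof. by rewrite /bsum /quad /psum mulr0 !addr0 !subrr !mul0r !addr0. Qed.

(** The trapezoid rule is exact on affine functions, whose sums along a closed contour therefore
    vanish at every depth, not only in the limit. *)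
Lemma bsum_affine_sub (R : realType) (h : Cplx R -> Cplx R) (k l : Cplx R)
    d (c s : Cplx R) :
  bsum (fun z => h z + (-1) * (k + l * z)) d c s = bsum h d c s.
Proof.
rewrite /bsum /quad /psum !(amean_lin _ h (fun z => k + l * z)) !amean_affine.
by field.
Qed.

Definition sq (R : realType) (c s : Cplx R) : set (Cplx R) :=
  [set z | exists x y : R, [/\ 0 <= x <= 1, 0 <= y <= 1 & z = c + s * mkC x y]].

Lemma mkCD (R : realType) (x y x' y' : R) :
  mkC x y + mkC x' y' = mkC (x + x') (y + y').
Proof. by []. Qed.

Lemma mkC_half (R : realType) (x y : R) : mkC x y / 2 = mkC (x / 2) (y / 2).
Proof. by rewrite (mkC_eta _ (_ / _)) cre_half cim_half. Qed.

Lemma midconvex_sq (R : realType) (c s : Cplx R) : midconvex R (sq R c s).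
Proof.
move=> _ _ [x [y [hx hy ->]]] [x' [y' [hx' hy' ->]]].
exists ((x + x') / 2), ((y + y') / 2); split.
- by move/andP: hx => [? ?]; move/andP: hx' => [? ?]; apply/andP; split; lra.
- by move/andP: hy => [? ?]; move/andP: hy' => [? ?]; apply/andP; split; lra.
- rewrite -mkC_half -mkCD; by field.
Qed.

Lemma sq_corner (R : realType) (c s : Cplx R) (x y : R) :
  0 <= x <= 1 -> 0 <= y <= 1 -> sq R c s (c + s * mkC x y).
Proof. by move=> hx hy; exists x, y. Qed.

Lemma mkC_00 (R : realType) : mkC 0 0 = 0 :> Cplx R. Proof. by []. Qed.
Lemma mkC_10 (R : realType) : mkC 1 0 = 1 :> Cplx R. Proof. by []. Qed.
Lemma mkC_11 (R : realType) : mkC 1 1 = 1 + iC R.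
Proof. by rewrite -mkC_10 /iC mkCD addr0 add0r. Qed.

Lemma sq_corners (R : realType) (c s : Cplx R) :
  [/\ sq R c s c, sq R c s (c + s), sq R c s (c + s + iC R * s) &
      sq R c s (c + iC R * s)].
Proof.
have z01 : 0 <= (0 : R) <= 1 by rewrite lexx ler01.
have o01 : 0 <= (1 : R) <= 1 by rewrite lexx ler01.
split.
- by have := sq_corner _ c s _ _ z01 z01; rewrite mkC_00 mulr0 addr0.
- by have := sq_corner _ c s _ _ o01 z01; rewrite mkC_10 mulr1.
- have := sq_corner _ c s _ _ o01 o01; rewrite mkC_11.
  by have -> : c + s * (1 + iC R) = c + s + iC R * s by ring.
- by have := sq_corner _ c s _ _ z01 o01; rewrite -/(iC R) mulrC.
Qed.

Lemma sq_diam (R : realType) (c s z w : Cplx R) :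
  sq R c s z -> sq R c s w -> cabs (z - w) <= 2 * cabs s.
Proof.
move=> [x [y [/andP[? ?] /andP[? ?] ->]]] [x' [y' [/andP[? ?] /andP[? ?] ->]]].
have -> : c + s * mkC x y - (c + s * mkC x' y') = s * (mkC x y - mkC x' y').
  by ring.
rewrite cabsM mulrC; apply: ler_wpM2r; first exact: cabs_ge0.
apply: le_trans (cabs_le_reim _ _) _.
rewrite creD cimD creN cimN /cre /cim /=.
have : `|x - x'| <= 1 by rewrite ler_norml; apply/andP; split; lra.
have : `|y - y'| <= 1 by rewrite ler_norml; apply/andP; split; lra.
lra.
Qed.

Lemma sq_sub (R : realType) (c t : Cplx R) (a b : R) :
  0 <= a <= 1 -> 0 <= b <= 1 ->
  sq R (c + t * mkC a b) t `<=` sq R c (t + t).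
Proof.
move=> /andP[? ?] /andP[? ?] z [x [y [/andP[? ?] /andP[? ?] ->]]].
exists ((a + x) / 2), ((b + y) / 2); split.
- by apply/andP; split; lra.
- by apply/andP; split; lra.
- rewrite -mkC_half -mkCD; by field.
Qed.

Lemma sq_children (R : realType) (c t : Cplx R) :
  [/\ sq R c t `<=` sq R c (t + t), sq R (c + t) t `<=` sq R c (t + t),
      sq R (c + t + iC R * t) t `<=` sq R c (t + t) &
      sq R (c + iC R * t) t `<=` sq R c (t + t)].
Proof.
have z01 : 0 <= (0 : R) <= 1 by rewrite lexx ler01.
have o01 : 0 <= (1 : R) <= 1 by rewrite lexx ler01.
split.
- by have := sq_sub _ c t _ _ z01 z01; rewrite mkC_00 mulr0 addr0.
- by have := sq_sub _ c t _ _ o01 z01; rewrite mkC_10 mulr1.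
- have := sq_sub _ c t _ _ o01 o01; rewrite mkC_11.
  by have -> : c + t * (1 + iC R) = c + t + iC R * t by ring.
- by have := sq_sub _ c t _ _ z01 o01; rewrite -/(iC R) (mulrC t).
Qed.

Lemma compact_sq (R : realType) (c s : Cplx R) : compact (sq R c s).
Proof.
have -> : sq R c s = (fun z => c + s * z) @` ((fun xy : R * R => mkC xy.1 xy.2)
    @` (`[0, 1]%classic `*` `[0, 1]%classic)).
  apply/seteqP; split.
    move=> _ [x [y [hx hy ->]]]; exists (mkC x y) => //.
    by exists (x, y) => //; split=> /=; rewrite in_itv.
  move=> _ [_ [[x y] /= [hx hy] <-] <-].
  by exists x, y; rewrite !in_itv /= in hx hy.
apply: continuous_compact; last first.
  apply: continuous_compact; last by apply: compact_setX; exact: segment_compact.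
  exact: continuous_subspaceT (@mkC_continuous R).
apply: continuous_subspaceT => z; apply/continuousCP => e e0.
have s1 : 0 < cabs s + 1 by rewrite ltr_wpDl // cabs_ge0.
exists (e / (cabs s + 1)) => [|w]; first exact: divr_gt0.
rewrite ltr_pdivlMr // => h.
have -> : c + s * w - (c + s * z) = (w - z) * s by ring.
rewrite cabsM; apply: le_lt_trans h; rewrite ler_wpM2l ?cabs_ge0 //; lra.
Qed.

Lemma psum_le (R : realType) (h : Cplx R -> Cplx R) (A : set (Cplx R)) (M : R)
    d a b :
  midconvex R A -> (forall z, A z -> cabs (h z) <= M) -> A a -> A b ->
  cabs (psum h d a b) <= cabs (b - a) * M.
Proof.
move=> cA hM Aa Ab; rewrite /psum cabsM ler_wpM2l ?cabs_ge0 //.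
exact: (amean_in _ h A [set w | cabs w <= M] cA (midconvex_disc _ M) hM).
Qed.

Lemma bsum_le (R : realType) (h : Cplx R -> Cplx R) (M : R) d (c s : Cplx R) :
  (forall z, sq R c s z -> cabs (h z) <= M) ->
  cabs (bsum h d c s) <= 4 * M * cabs s.
Proof.
move=> hM; have [c1 c2 c3 c4] := sq_corners _ c s.
have P := psum_le _ h _ M d _ _ (midconvex_sq _ c s) hM.
have := P _ _ c1 c2; have := P _ _ c2 c3; have := P _ _ c3 c4; have := P _ _ c4 c1.
have -> : c + s - c = s by ring.
have -> : c + s + iC R * s - (c + s) = iC R * s by ring.
have -> : c + iC R * s - (c + s + iC R * s) = - s by ring.
have -> : c - (c + iC R * s) = - (iC R * s) by ring.
rewrite !cabsN !(cabsM _ (iC R) s) cabs_iC mul1r /bsum /quad => h4 h3 h2 h1.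
apply: le_trans (cabsD _ _ _) _.
apply: le_trans (lerD (cabsD _ _ _) (lexx _)) _.
apply: le_trans (lerD (lerD (cabsD _ _ _) (lexx _)) (lexx _)) _.
lra.
Qed.

Lemma half_half (R : realType) (s : Cplx R) : s / 2 + s / 2 = s.
Proof. by field. Qed.

Lemma cabs_half (R : realType) (s : Cplx R) : cabs (s / 2) = cabs s / 2.
Proof. by rewrite cabsM cabsV cabs2. Qed.

(* If a square violates the bound [e * side ^ 2], so does one of its four
   quarters; the nested squares obtained in this way shrink to a point where
   differentiability is contradicted. *)
Lemma goursat (R : realType) (f : Cplx R -> Cplx R) (c s : Cplx R) :
  (forall z, sq R c s z -> hol f z) ->
  forall e : R, 0 < e ->
  exists D, forall d, (D <= d)%N -> cabs (bsum f d c s) <= e * cabs s ^+ 2.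
Proof.
move=> df e e0; apply: contrapT => notT.
pose T (x : Cplx R * Cplx R) := exists D, forall d, (D <= d)%N ->
  cabs (bsum f d x.1 x.2) <= e * cabs x.2 ^+ 2.
have step (x : Cplx R * Cplx R) : exists c', ~ T x ->
    ~ T (c', x.2 / 2) /\ sq R c' (x.2 / 2) `<=` sq R x.1 x.2.
  have [Tx|nTx] := pselect (T x); first by exists 0.
  apply: contrapT => /forallNP H; apply: nTx.
  have K c' : sq R c' (x.2 / 2) `<=` sq R x.1 x.2 -> T (c', x.2 / 2).
    by move=> hs; apply: contrapT => nT; apply: (H c').
  case: x H K => {df notT}c {}s /= H K; set t := s / 2 in K.
  have [k1 k2 k3 k4] := sq_children _ c t.
  rewrite /t half_half -/t in k1 k2 k3 k4.
  have [D1 h1] := K _ k1; have [D2 h2] := K _ k2.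
  have [D3 h3] := K _ k3; have [D4 h4] := K _ k4.
  (* Splitting into quarters uses up one level of bisection, hence the successor. *)
  exists (D1 + D2 + D3 + D4).+1 => -[|d] //= hd.
  rewrite ltnS in hd.
  have /h1 /= {}h1 : (D1 <= d)%N by rewrite (leq_trans _ hd) // -!addnA leq_addr.
  have /h2 /= {}h2 : (D2 <= d)%N.
    by rewrite (leq_trans _ hd) // -!addnA addnCA leq_addr.
  have /h3 /= {}h3 : (D3 <= d)%N.
    by rewrite (leq_trans _ hd) // -addnA addnCA leq_addr.
  have /h4 /= {}h4 : (D4 <= d)%N by rewrite (leq_trans _ hd) // leq_addl.
  rewrite -{1}(half_half _ s) bsum_split -/t.
  apply: le_trans (cabsD _ _ _) _.
  apply: le_trans (lerD (cabsD _ _ _) (lexx _)) _.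
  apply: le_trans (lerD (lerD (cabsD _ _ _) (lexx _)) (lexx _)) _.
  have -> : cabs s = 2 * cabs t by rewrite /t cabs_half; field.
  rewrite exprMn; lra.
have [nxt nxtP] := choice step.
pose q k := iter k (fun x => (nxt x, x.2 / 2)) (c, s).
have q2 k : cabs (q k).2 = cabs s / 2 ^+ k.
  elim: k => [|k IH]; first by rewrite expr0 divr1.
  by rewrite /= cabs_half IH exprS; field; rewrite expf_neq0.
have qT k : ~ T (q k).
  elim: k => [//|k IH]; exact: (nxtP (q k) IH).1.
have qS k m : sq R (q (k + m)%N).1 (q (k + m)%N).2 `<=` sq R (q k).1 (q k).2.
  elim: m => [|m IH]; first by rewrite addn0.
  rewrite addnS; apply: subset_trans IH.
  exact: (nxtP (q (k + m)%N) (qT _)).2.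
(* Along an ultrafilter finer than [\oo] the corners converge, and the limit lies in every square
   because the corners eventually do. *)
have [F [FU oF]] := @ultraFilterLemma nat \oo eventually_filter.
have inq k : F ((fun m => (q m).1) @^-1` (sq R (q k).1 (q k).2)).
  apply: oF; exists k => // m /= km; rewrite -(subnKC km).
  have [c1 _ _ _] := sq_corners _ (q (k + (m - k))%N).1 (q (k + (m - k))%N).2.
  exact: qS c1.
have [p _ qp] := ultra_compact_cvg _ _ F _ _ FU (compact_sq _ _ _) (inq 0%N).
have pq k : sq R (q k).1 (q k).2 p.
  have [l sl ql] := ultra_compact_cvg _ _ F _ _ FU (compact_sq _ _ _) (inq k).
  suff -> : p = l by [].
  exact: (@cvg_unique _ (@norm_hausdorff _ (Cplx R)) _ _ _ _ qp ql).
have /holP[L hL] := df p (pq 0%N).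
(* [bsum_le] contributes a factor 4 and the diameter of the square a factor 2. *)
have e8 : 0 < e / 8 by rewrite divr_gt0.
have [r r0 hr] := hL _ e8.
have [k hk] : exists k, 2 * (cabs s / 2 ^+ k) < r.
  pose k := (Num.truncn (2 * cabs s / r)).+1.
  exists k.
  have : 2 * cabs s / r < k%:R by rewrite /k truncnS_gt.
  have kk : (k%:R : R) <= 2 ^+ k.
    by rewrite -natrX ler_nat ltnW // ltn_expl.
  move=> /lt_le_trans /(_ kk).
  by rewrite mulrA ltr_pdivrMr // ltr_pdivrMr ?exprn_gt0 // (mulrC r).
apply: (qT k); exists 0%N => d _.
rewrite -(bsum_affine_sub _ f (f p - L * p) L).
apply: le_trans (bsum_le _ _ (e / 8 * (2 * cabs (q k).2)) _ _ _ _) _; last first.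
  by rewrite expr2; lra.
move=> z zq.
have zp := sq_diam _ _ _ _ _ zq (pq k).
have -> : f z + -1 * (f p - L * p + L * z) = f z - f p - L * (z - p) by ring.
apply: le_trans (hr z _) _; first by apply: le_lt_trans zp _; rewrite q2.
by rewrite ler_pM2l.
Qed.

(** At the exceptional corner [c] boundedness replaces differentiability. Quartering repeatedly
    towards [c] leaves three quarters per stage to [goursat]; the last square at [c] has so small a
    perimeter that the bound [M] makes its sum negligible. After m stages the remaining depth is
    [d - m]. *)
Lemma goursat_corner (R : realType) (f : Cplx R -> Cplx R) (c s : Cplx R)
    (M r : R) : 0 < r ->
  (forall z, sq R c s z -> z != c -> hol f z) ->
  (forall z, sq R c s z -> cabs (z - c) < r -> cabs (f z) <= M) ->
  forall e : R, 0 < e ->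
  exists D, forall d, (D <= d)%N -> cabs (bsum f d c s) <= e.
Proof.
move=> r0 df fM e e0.
have [s0|s0] := eqVneq s 0.
  by exists 0%N => d _; rewrite s0 bsum0 cabs0 ltW.
have M0 : 0 <= M.
  have [c1 _ _ _] := sq_corners _ c s.
  by apply: le_trans (cabs_ge0 _ _) (fM c c1 _); rewrite subrr cabs0.
have ind m : forall s e, 0 < e -> s != 0 ->
    (forall z, sq R c s z -> z != c -> hol f z) ->
    sq R c (s / 2 ^+ m) `<=` sq R c s /\
    exists D, forall d, (D <= d)%N ->
      cabs (bsum f d c s) <= e + cabs (bsum f (d - m) c (s / 2 ^+ m)).
  elim: m => [|m IH] {e0 s0 df fM} {}s {}e e0 s0 df.
    rewrite expr0 divr1; split=> //; exists 0%N => d _.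
    by rewrite subn0 lerDr ltW.
  pose t := s / 2; have ts : t + t = s by rewrite half_half.
  have t0 : t != 0 by apply: contraNneq s0 => t0; rewrite -ts t0 addr0.
  have [k1 k2 k3 k4] := sq_children _ c t; rewrite ts in k1 k2 k3 k4.
  have e2 : 0 < e / 2 by rewrite divr_gt0.
  have [|sub [D0 h0]] := IH t _ e2 t0.
    by move=> z /k1; exact: df.
  have -> : s / 2 ^+ m.+1 = t / 2 ^+ m.
    by rewrite /t exprS; field; rewrite expf_neq0.
  split; first exact: subset_trans sub k1.
  (* The three quarters away from the corner get e / 6 each, and the induction hypothesis the other
     half of e. *)
  pose e' := e / (6 * cabs t ^+ 2).
  have ct : 0 < cabs t by rewrite cabs_gt0.
  have e'0 : 0 < e' by rewrite divr_gt0 // mulr_gt0 // exprn_gt0.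
  have ee : e' * cabs t ^+ 2 = e / 6.
    by rewrite /e'; field; rewrite gt_eqF.
  have away a b c' : c' = c + t * mkC a b -> 0 <= a -> 0 <= b -> 0 < a + b ->
      sq R c' t `<=` sq R c s -> forall z, sq R c' t z -> hol f z.
    move=> -> a0 b0 ab sub' z zs; apply: df; first exact: sub'.
    case: zs => x [y [/andP[x0 _] /andP[y0 _] ->]].
    rewrite -addrA -mulrDr -subr_eq0 [c + _]addrC addrK mulf_neq0 //.
    rewrite mkCD; apply: contraTneq ab => -[xa yb].
    by rewrite -leNgt; lra.
  have [|D1 h1] := goursat _ f (c + t) t _ _ e'0.
    by apply: (away 1 0) => //; rewrite ?mkC_10 ?mulr1 // addr0.
  have [|D2 h2] := goursat _ f (c + t + iC R * t) t _ _ e'0.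
    by apply: (away 1 1) => //; rewrite mkC_11; ring.
  have [|D3 h3] := goursat _ f (c + iC R * t) t _ _ e'0.
    by apply: (away 0 1) => //; rewrite -/(iC R) ?(mulrC t) // add0r.
  exists (D0 + D1 + D2 + D3).+1 => -[|d] //= hd.
  rewrite ltnS in hd; rewrite subSS.
  have /h0 {}h0 : (D0 <= d)%N by rewrite (leq_trans _ hd) // -!addnA leq_addr.
  have /h1 {}h1 : (D1 <= d)%N.
    by rewrite (leq_trans _ hd) // -!addnA addnCA leq_addr.
  have /h2 {}h2 : (D2 <= d)%N.
    by rewrite (leq_trans _ hd) // -addnA addnCA leq_addr.
  have /h3 {}h3 : (D3 <= d)%N by rewrite (leq_trans _ hd) // leq_addl.
  rewrite ee in h1 h2 h3.
  rewrite -ts bsum_split.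
  apply: le_trans (cabsD _ _ _) _.
  apply: le_trans (lerD (cabsD _ _ _) (lexx _)) _.
  apply: le_trans (lerD (lerD (cabsD _ _ _) (lexx _)) (lexx _)) _.
  lra.
have e2 : 0 < e / 2 by rewrite divr_gt0.
(* Below r the bound [M] applies; below e / (4 M + 1) the last square, whose side is less than b /
   2, contributes at most e / 2. *)
pose b := Num.min r (e / (4 * M + 1)).
have M1 : 0 < 4 * M + 1 by lra.
have b0 : 0 < b by rewrite /b lt_min r0 divr_gt0.
have [k hk] : exists k, 2 * cabs s / 2 ^+ k < b.
  pose k := (Num.truncn (2 * cabs s / b)).+1.
  exists k.
  have : 2 * cabs s / b < k%:R by rewrite /k truncnS_gt.
  have kk : (k%:R : R) <= 2 ^+ k.
    by rewrite -natrX ler_nat ltnW // ltn_expl.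
  move=> /lt_le_trans /(_ kk).
  by rewrite ltr_pdivrMr // ltr_pdivrMr ?exprn_gt0 // (mulrC b).
have [sub [D hD]] := ind k _ _ e2 s0 df.
exists D => d /hD; move/le_trans; apply.
have cs : cabs (s / 2 ^+ k) = cabs s / 2 ^+ k by rewrite cabsM cabsV cabsX cabs2.
have [c1 _ _ _] := sq_corners _ c (s / 2 ^+ k).
have br : b <= r by rewrite /b ge_min lexx.
have be : b <= e / (4 * M + 1) by rewrite /b ge_min lexx orbT.
rewrite ler_pdivlMr // in be.
have : cabs (bsum f (d - k) c (s / 2 ^+ k)) <= 4 * M * cabs (s / 2 ^+ k).
  apply: bsum_le => z zs; apply: fM; first exact: sub.
  apply: lt_le_trans br; apply: le_lt_trans hk.
  by rewrite -mulrA -cs; exact: sq_diam zs c1.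
have x0 := cabs_ge0 _ (s / 2 ^+ k).
rewrite -mulrA -cs in hk.
move: (cabs (s / 2 ^+ k)) x0 hk => x x0 hk.
have : 2 * x * (4 * M + 1) <= b * (4 * M + 1) by rewrite ler_pM2r // ltW.
nra.
Qed.

(** This set and the one in [midconvex_top] are the two sides, avoiding the corner 0, of the square
    with opposite corners 0 and r + i r. *)
Lemma midconvex_right (R : realType) (r : R) :
  midconvex R [set z | cre z = r /\ 0 <= cim z <= r].
Proof. move=> a b /= [ha /andP[a0 a1]] [hb /andP[b0 b1]].
rewrite cre_half cim_half creD cimD ha hb; split; first by field.
by apply/andP; split; lra.
Qed.

Lemma midconvex_top (R : realType) (r : R) :
  midconvex R [set z | 0 <= cre z <= r /\ cim z = r].
Proof. move=> a b /= [/andP[a0 a1] ha] [/andP[b0 b1] hb].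
rewrite cre_half cim_half creD cimD ha hb; split; last by field.
by apply/andP; split; lra.
Qed.

Lemma cre_mkC (R : realType) (x y : R) : cre (mkC x y) = x. Proof. by []. Qed.
Lemma cim_mkC (R : realType) (x y : R) : cim (mkC x y) = y. Proof. by []. Qed.

(** The hypothesis says that the form h(z) dz is invariant under the rotation z -> i z. *)
Lemma psum_rot (R : realType) (h : Cplx R -> Cplx R) d a b :
  (forall z, h (iC R * z) * iC R = h z) ->
  psum h d (iC R * a) (iC R * b) = psum h d a b.
Proof. move=> hi.
have am : amean h d (iC R * a) (iC R * b) * iC R = amean h d a b.
  elim: d a b => [|d IH] a b /=; first by rewrite -(hi a) -(hi b); field.
  rewrite -(IH a ((a + b) / 2)) -(IH ((a + b) / 2) b).
  have -> : (iC R * a + iC R * b) / 2 = iC R * ((a + b) / 2) by field.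
  by field.
by rewrite /psum -am; ring.
Qed.

(* Both edges have argument variation pi / 4 around 0. *)
Lemma psum_inv_ge1 (R : realType) (r : R) d : 0 < r ->
  1 <= cabs (psum (fun z => z^-1) d (mkC r 0) (mkC r r) +
             psum (fun z => z^-1) d (mkC r r) (mkC 0 r)).
Proof. move=> r0; apply: le_trans (cabs_im _ _); apply: le_trans (ler_norm _).
(* On the right edge Re (1 / z) >= 1 / (2 r) and the increment is i r; on the top edge Im (1 / z) <=
   - 1 / (2 r) and the increment is - r. Each edge has a sum of imaginary part at least 1 / 2. *)
have m0 : 0 < (2 * r)^-1 by rewrite invr_gt0 mulr_gt0.
pose B1 : set (Cplx R) := [set w | (2 * r)^-1 <= cre w].
pose B2 : set (Cplx R) := [set w | cim w <= - (2 * r)^-1].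
have h1 : B1 (amean (fun z => z^-1) d (mkC r 0) (mkC r r)).
  apply: (amean_in _ _ _ B1 (midconvex_right _ r)).
  - by move=> a b; rewrite /B1 /= => ha hb; rewrite cre_half creD; lra.
  - move=> z [zr /andP[z0 zi]]; rewrite /B1 /= creV zr sqr_cabs zr.
    have zz : 0 < r ^+ 2 + cim z ^+ 2 by rewrite ltr_pwDl ?exprn_gt0 ?sqr_ge0.
    rewrite ler_pdivlMr // ler_pdivrMl ?mulr_gt0 //. nra.
  - by split=> //; rewrite cim_mkC lexx ltW.
  - by split=> //; rewrite cim_mkC lexx ltW.
have h2 : B2 (amean (fun z => z^-1) d (mkC r r) (mkC 0 r)).
  apply: (amean_in _ _ _ B2 (midconvex_top _ r)).
  - by move=> a b; rewrite /B2 /= => ha hb; rewrite cim_half cimD; lra.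
  - move=> z [/andP[z0 zi] zr]; rewrite /B2 /= cimV zr sqr_cabs zr lerN2.
    have zz : 0 < cre z ^+ 2 + r ^+ 2 by rewrite ltr_pwDr ?exprn_gt0 ?sqr_ge0.
    rewrite ler_pdivlMr // ler_pdivrMl ?mulr_gt0 //. nra.
  - by split=> //; rewrite cre_mkC lexx ltW.
  - by split=> //; rewrite cre_mkC lexx ltW.
rewrite /B1 /B2 /= in h1 h2.
rewrite cimD /psum !cimM !creD !creN !cimD !cimN !cre_mkC !cim_mkC.
move: (amean _ _ _ _) h1 => a h1; move: (amean _ _ _ _) h2 => b h2.
have rm : r * (2 * r)^-1 = 1 / 2 by field; rewrite gt_eqF.
have : r * (2 * r)^-1 <= r * cre a by rewrite ler_pM2l.
have : r * (2 * r)^-1 <= r * - cim b by rewrite ler_pM2l // lerNr.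
rewrite rm; lra.
Qed.

(** * Closure properties of complex differentiability and the weak maximum principle *)

Lemma holC (R : realType) (c z : Cplx R) : hol (fun _ : Cplx R => c) z.
Proof. exact: derivable_cst. Qed.

Lemma holX (R : realType) (z : Cplx R) : hol (fun w : Cplx R => w) z.
Proof. exact: derivable_id. Qed.

Lemma holD (R : realType) (f g : Cplx R -> Cplx R) (z : Cplx R) :
  hol f z -> hol g z -> hol (fun w => f w + g w) z.
Proof. by move=> hf hg; exact: (derivableD hf hg). Qed.

Lemma holN (R : realType) (f : Cplx R -> Cplx R) (z : Cplx R) :
  hol f z -> hol (fun w => - f w) z.
Proof. by move=> hf; exact: (derivableN hf). Qed.

Lemma holB (R : realType) (f g : Cplx R -> Cplx R) (z : Cplx R) :
  hol f z -> hol g z -> hol (fun w => f w - g w) z.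
Proof. by move=> hf hg; exact: (derivableB hf hg). Qed.

Lemma holM (R : realType) (f g : Cplx R -> Cplx R) (z : Cplx R) :
  hol f z -> hol g z -> hol (fun w => f w * g w) z.
Proof. by move=> hf hg; exact: (derivableM hf hg). Qed.

Lemma holV (R : realType) (f : Cplx R -> Cplx R) (z : Cplx R) :
  f z != 0 -> hol f z -> hol (fun w => (f w)^-1) z.
Proof. by move=> fz hf; exact: (derivableV fz hf). Qed.

(* Sealed, because unfolding the modulus or the limit makes unification
   diverge. *)
Opaque cabs cre cim hol.

Lemma hol_ext (R : realType) (f g : Cplx R -> Cplx R) (z : Cplx R) :
  f =1 g -> hol f z -> hol g z.
Proof. by move=> /funext ->. Qed.

Lemma hol_pow (R : realType) (f : Cplx R -> Cplx R) (z : Cplx R) n :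
  hol f z -> hol (fun w => f w ^+ n) z.
Proof.
move=> hf; elim: n => [|n IH].
  by apply: (hol_ext _ (fun=> 1)); [move=> w; rewrite expr0|exact: holC].
apply: (hol_ext _ (fun w => f w * f w ^+ n)); first by move=> w; rewrite exprS.
exact: holM.
Qed.

Lemma hol_sum (R : realType) (I : Type) (s : seq I) (P : pred I)
    (F : I -> Cplx R -> Cplx R) (z : Cplx R) :
  (forall i, P i -> hol (F i) z) -> hol (fun w => \sum_(i <- s | P i) F i w) z.
Proof.
move=> hF; elim: s => [|i s IH].
  by apply: (hol_ext _ (fun=> 0)); [move=> w; rewrite big_nil|exact: holC].
have [Pi|Pi] := boolP (P i).
  apply: (hol_ext _ (fun w => F i w + \sum_(j <- s | P j) F j w)).
    by move=> w; rewrite big_cons Pi.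
  by apply: holD; [exact: hF|exact: IH].
apply: (hol_ext _ (fun w => \sum_(j <- s | P j) F j w)); last exact: IH.
by move=> w; rewrite big_cons (negbTE Pi).
Qed.

Lemma hol_prod (R : realType) (I : Type) (s : seq I) (P : pred I)
    (F : I -> Cplx R -> Cplx R) (z : Cplx R) :
  (forall i, P i -> hol (F i) z) -> hol (fun w => \prod_(i <- s | P i) F i w) z.
Proof.
move=> hF; elim: s => [|i s IH].
  by apply: (hol_ext _ (fun=> 1)); [move=> w; rewrite big_nil|exact: holC].
have [Pi|Pi] := boolP (P i).
  apply: (hol_ext _ (fun w => F i w * \prod_(j <- s | P j) F j w)).
    by move=> w; rewrite big_cons Pi.
  by apply: holM; [exact: hF|exact: IH].
apply: (hol_ext _ (fun w => \prod_(j <- s | P j) F j w)); last exact: IH.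
by move=> w; rewrite big_cons (negbTE Pi).
Qed.

Lemma hol_rot (R : realType) (f : Cplx R -> Cplx R) (p u z : Cplx R) :
  cabs u = 1 -> hol f (p + u * z) -> hol (fun w => f (p + u * w)) z.
Proof.
move=> u1 /holP[L h]; apply/holP; exists (L * u) => e e0.
have [d d0 hd] := h e e0; exists d; [exact: d0|move=> w wz].
have E : p + u * w - (p + u * z) = u * (w - z) by ring.
have := hd (p + u * w); rewrite E cabsM u1 mul1r => /(_ wz).
by rewrite mulrA.
Qed.

Lemma mkC_real_decomp (R : realType) (x y : R) :
  mkC x y = mkC x 0 + iC R * mkC y 0.
Proof.
rewrite [RHS]mkC_eta creD cimD creM cimM /iC !cre_mkC !cim_mkC.
by congr mkC; ring.
Qed.

(* With G the sum of f over the four rotations about p, the rotation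
   z -> i z preserves (G z - G 0) / z dz, so the two edges through 0 of the
   square with corner 0 do not contribute to its contour sum. *)
Lemma weak_maximum (R : realType) (f : Cplx R -> Cplx R) (p : Cplx R)
    (r M : R) : 0 < r ->
  (forall z, cabs (z - p) <= 2 * r -> hol f z) ->
  (forall z, r <= cabs (z - p) <= 2 * r -> cabs (f z) <= M) ->
  cabs (f p) <= 2 * M.
Proof.
move=> r0 df fM.
pose i := iC R.
have i2 : i * i = -1 := sqr_iC R.
have ci : cabs i = 1 := cabs_iC R.
pose G z := f (p + 1 * z) + f (p + i * z) + f (p + (-1) * z) + f (p + (- i) * z).
have cN1 : cabs (-1 : Cplx R) = 1 by rewrite cabsN cabs1.
have cNi : cabs (- i) = 1 by rewrite cabsN.
have pu u z : cabs u = 1 -> cabs (p + u * z - p) = cabs z.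
  by move=> u1; rewrite addrC addKr cabsM u1 mul1r.
have dG z : cabs z <= 2 * r -> hol G z.
  move=> zr.
  have dd u : cabs u = 1 -> hol (fun w => f (p + u * w)) z.
    by move=> u1; apply: (hol_rot _ _ _ _ _ u1); apply: df; rewrite pu.
  exact: holD _ _ _ _ (holD _ _ _ _ (holD _ _ _ _ (dd _ (cabs1 R)) (dd _ ci))
    (dd _ cN1)) (dd _ cNi).
have GM z : r <= cabs z <= 2 * r -> cabs (G z) <= 4 * M.
  move=> zr.
  have bd u : cabs u = 1 -> cabs (f (p + u * z)) <= M.
    by move=> u1; apply: fM; rewrite pu.
  have h1 := bd _ (cabs1 R); have h2 := bd _ ci.
  have h3 := bd _ cN1; have h4 := bd _ cNi.
  apply: le_trans (cabsD _ _ _) _.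
  apply: le_trans (lerD (cabsD _ _ _) (lexx _)) _.
  apply: le_trans (lerD (lerD (cabsD _ _ _) (lexx _)) (lexx _)) _.
  lra.
have G0 : G 0 = 4 * f p by rewrite /G !mulr0 addr0; ring.
have Gi z : G (i * z) = G z.
  rewrite /G.
  have -> : p + 1 * (i * z) = p + i * z by ring.
  have -> : p + i * (i * z) = p + (-1) * z by rewrite mulrA i2.
  have -> : p + (-1) * (i * z) = p + (- i) * z by ring.
  have -> : p + (- i) * (i * z) = p + 1 * z by rewrite mulrA mulNr i2 opprK.
  ring.
pose k z := (G z - G 0) / z.
have ki z : k (i * z) * i = k z.
  have i0 : i != 0 by rewrite -cabs_eq0 ci oner_eq0.
  have [->|z0] := eqVneq z 0; first by rewrite /k mulr0 subrr !mul0r.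
  by rewrite /k Gi; field; rewrite z0 i0.
pose s : Cplx R := mkC r 0.
have cs : cabs s = r by rewrite cabs_real gtr0_norm.
have sqr z : sq R 0 s z -> cabs z <= 2 * r.
  move=> zs; have [c1 _ _ _] := sq_corners _ 0 s.
  by have := sq_diam _ _ _ _ _ zs c1; rewrite subr0 cs.
have kd z : sq R 0 s z -> z != 0 -> hol k z.
  move=> zs z0; apply: holM; last exact: holV z0 (holX _ _).
  by apply: holB; [apply: dG; exact: sqr|exact: holC].
have /holP[L hL] : hol G 0 by apply: dG; rewrite cabs0; lra.
have [t t0 ht] := hL 1 ltr01.
(* Differentiability of [G] at 0 bounds the quotient near 0, as [goursat_corner] asks at its
   exceptional corner. *)
have kb z : sq R 0 s z -> cabs (z - 0) < t -> cabs (k z) <= 1 + cabs L.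
  move=> _ zt; have := ht z zt; rewrite !subr0 mul1r => h.
  have [->|z0] := eqVneq z 0.
    by rewrite /k invr0 mulr0 cabs0 addr_ge0 // cabs_ge0.
  have cz : 0 < cabs z by rewrite cabs_gt0.
  rewrite /k cabsM cabsV ler_pdivrMr // mulrDl mul1r.
  have -> : G z - G 0 = (G z - G 0 - L * z) + L * z by ring.
  by apply: le_trans (cabsD _ _ _) _; rewrite cabsM lerD2r.
have key := goursat_corner _ k 0 s _ _ t0 kd kb.
apply/ler_addgt0Pr => e e0.
have e4 : 0 < 4 * e by rewrite mulr_gt0.
have [D hD] := key _ e4.
have := hD D (leqnn _) => {hD}.
pose E1 h := psum h D s (s + i * s) + psum h D (s + i * s) (i * s).
have -> : bsum k D 0 s = E1 k.
  rewrite /bsum /quad !add0r -/i.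
  have -> : psum k D (i * s) 0 = - psum k D 0 s.
    by rewrite -(psum_rev _ k D s 0) -{1}[0 : Cplx R](mulr0 i) psum_rot.
  rewrite /E1; ring.
have -> : E1 k = E1 (fun z => G z / z) - G 0 * E1 (fun z => z^-1).
  rewrite /E1 /psum.
  have am a b : amean k D a b = amean (fun z => G z / z) D a b
      + (- G 0) * amean (fun z => z^-1) D a b.
    rewrite -amean_lin; congr amean; apply/funext => z.
    by rewrite /k mulrBl mulNr.
  by rewrite !am; ring.
have s1 : s + i * s = mkC r r by rewrite [RHS]mkC_real_decomp.
have s2 : i * s = mkC 0 r by rewrite [RHS]mkC_real_decomp mkC_00 add0r.
have inv1 := psum_inv_ge1 _ r D r0.
rewrite -/s -s1 -s2 in inv1.
(* The two edges away from 0 have length r, so the sums of G(z) / z over them total at most 8 M in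
   modulus, while G(0) = 4 f(p) is multiplied by a sum of modulus at least 1. This is where the
   factor 2 of the conclusion comes from. *)
have edge z : r <= cabs z -> cabs z <= 2 * r -> cabs (G z / z) <= 4 * M / r.
  move=> z1 z2; have := GM z; rewrite z1 z2 => /(_ isT) h.
  rewrite cabsM cabsV.
  have c0 : 0 < cabs z by apply: lt_le_trans z1.
  rewrite ler_pdivrMr // mulrAC ler_pdivlMr //.
  have M0 := le_trans (cabs_ge0 _ _) h.
  by apply: le_trans (ler_wpM2r (ltW r0) h) _; rewrite ler_wpM2l.
have e1 : cabs (psum (fun z => G z / z) D s (s + i * s)) <=
    cabs (s + i * s - s) * (4 * M / r).
  apply: (psum_le _ _ _ _ _ _ _ (midconvex_right _ r)).
  - move=> z [zr /andP[z0 z1]]; apply: edge.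
      by apply: le_trans (cabs_re _ z); rewrite zr ler_norm.
    apply: le_trans (cabs_le_reim _ _) _; rewrite zr (gtr0_norm r0) (ger0_norm z0); lra.
  - by split=> //; rewrite cim_mkC lexx ltW.
  - by rewrite s1; split=> //; rewrite cim_mkC lexx ltW.
have e2 : cabs (psum (fun z => G z / z) D (s + i * s) (i * s)) <=
    cabs (i * s - (s + i * s)) * (4 * M / r).
  apply: (psum_le _ _ _ _ _ _ _ (midconvex_top _ r)).
  - move=> z [/andP[z0 z1] zr]; apply: edge.
      by apply: le_trans (cabs_im _ z); rewrite zr ler_norm.
    apply: le_trans (cabs_le_reim _ _) _; rewrite zr (gtr0_norm r0) (ger0_norm z0); lra.
  - by rewrite s1; split=> //; rewrite cre_mkC lexx ltW.
  - by rewrite s2; split=> //; rewrite cre_mkC lexx ltW.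
have E0 : s + i * s - s = i * s by ring.
have E00 : i * s - (s + i * s) = - s by ring.
rewrite E0 cabsM ci mul1r cs in e1.
rewrite E00 cabsN cs in e2.
have rM : r * (4 * M / r) = 4 * M by field; rewrite gt_eqF.
rewrite rM in e1 e2.
move=> hE.
have hA : cabs (E1 (fun z => G z / z)) <= 8 * M.
  by apply: le_trans (cabsD _ _ _) _; lra.
have hG : cabs (G 0 * E1 (fun z => z^-1)) <= 8 * M + 4 * e.
  have -> : G 0 * E1 (fun z => z^-1) = E1 (fun z => G z / z) -
     (E1 (fun z => G z / z) - G 0 * E1 (fun z => z^-1)) by ring.
  by apply: le_trans (cabsB _ _ _) _; lra.
rewrite cabsM G0 cabsM in hG.
have c4 : cabs (4 : Cplx R) = 4 by rewrite (natrM _ 2 2) cabsM !cabs2 -natrM.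
rewrite c4 in hG.
have := ler_wpM2l (mulr_ge0 (ler0n _ 4) (cabs_ge0 _ (f p))) inv1.
rewrite mulr1 => /le_trans /(_ hG); lra.
Qed.

(** * Maximum principle *)

Lemma bernoulli_ge (R : realType) (x : R) n : 0 <= x -> 1 + n%:R * x <= (1 + x) ^+ n.
Proof.
move=> x0; elim: n => [|n IH]; first by rewrite mul0r addr0 expr0.
rewrite exprS -natr1.
have h : (1 + x) * (1 + n%:R * x) <= (1 + x) * (1 + x) ^+ n.
  by rewrite ler_wpM2l // addr_ge0.
apply: le_trans h.
have : 0 <= n%:R * x * x by rewrite !mulr_ge0.
nra.
Qed.

(** The n-th root of [C] tends to 1; Bernoulli's inequality expresses this without roots. *)
Lemma power_trick (R : realType) (a b C : R) :
  0 <= b -> (forall n, a ^+ n <= C * b ^+ n) -> a <= b.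
Proof.
move=> b0 h; rewrite leNgt; apply/negP => ba.
have [b00|bn] := eqVneq b 0.
  have := h 1%N; rewrite !expr1 b00 mulr0 => a0.
  by have := le_lt_trans a0 (le_lt_trans b0 ba); rewrite ltxx.
have bp : 0 < b by rewrite lt_def bn b0.
pose x := a / b - 1.
have x0 : 0 < x by rewrite /x subr_gt0 ltr_pdivlMr // mul1r.
have ab : a / b = 1 + x by rewrite /x addrC subrK.
have hn n : (1 + x) ^+ n <= C.
  by rewrite -ab expr_div_n ler_pdivrMr ?exprn_gt0.
pose k := (Num.truncn (C / x)).+1.
have : C / x < k%:R by rewrite /k truncnS_gt.
rewrite ltr_pdivrMr // => Ck.
have := le_trans (bernoulli_ge _ x k (ltW x0)) (hn k).
by rewrite leNgt; apply/negP; rewrite negbK; apply: lt_trans Ck _; rewrite ltrDr ltr01.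
Qed.

Lemma open_discP (R : realType) (Om : set (Cplx R)) (p : Cplx R) :
  open Om -> Om p -> exists2 r : R, 0 < r & forall w, cabs (w - p) < r -> Om w.
Proof. by move=> oO Op; apply/nbhsCP; exact: open_nbhs_nbhs. Qed.

(** Lagrange's identity: for e > 0 the last term is the defect in the Cauchy-Schwarz inequality for
    (1, sqrt e z) and (1, sqrt e p). The [mkC] term is e conj(p), which keeps the left-hand factor
    holomorphic in z. *)
Lemma sqr_cabs_kernel (R : realType) (e : R) (z p : Cplx R) :
  cabs (1 + z * mkC (e * cre p) (- (e * cim p))) ^+ 2 =
  (1 + e * cabs z ^+ 2) * (1 + e * cabs p ^+ 2) - e * cabs (z - p) ^+ 2.
Proof.
rewrite !sqr_cabs !creD !cimD creM cimM creN cimN cre_mkC cim_mkC.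
have -> : cre (1 : Cplx R) = 1 by [].
have -> : cim (1 : Cplx R) = 0 by [].
ring.
Qed.

Lemma cabs_continuous0 (R : realType) : continuous (fun z : Cplx R => cabs z).
Proof.
move=> z; have := @cabs_continuous R 0 z.
have -> : (fun w : Cplx R => cabs (w - 0)) = cabs.
  by apply/funext => w; rewrite subr0.
by [].
Qed.

Lemma cabs_sqr_weight_continuous (R : realType) (f : Cplx R -> Cplx R) (e : R)
    (z : Cplx R) : hol f z ->
  {for z, continuous (fun w => cabs (f w) ^+ 2 * (1 + e * cabs w ^+ 2))}.
Proof.
move=> hf.
have c0 : {for z, continuous (fun w : Cplx R => cabs w)}.
  exact: cabs_continuous0.
have cf : {for z, continuous (fun w => cabs (f w))}.
  apply: (@continuous_comp _ _ _ f cabs); first exact: hol_continuous.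
  exact: cabs_continuous0.
have NF := nbhs_filter z.
have cM (g h : Cplx R -> R) : {for z, continuous g} -> {for z, continuous h} ->
    {for z, continuous (fun w => g w * h w)}.
  by move=> cg ch; exact: (cvgM cg ch).
have ce : {for z, continuous (fun w : Cplx R => e * cabs w ^+ 2)}.
  by apply: (cM (fun=> e)); [exact: cvg_cst|exact: (cM _ _ c0 c0)].
have cD : {for z, continuous (fun w : Cplx R => 1 + e * cabs w ^+ 2)}.
  have c1 : {for z, continuous (fun _ : Cplx R => 1 : R)} by exact: cvg_cst.
  by exact: (cvgD c1 ce).
exact: (cM _ _ (cM _ _ cf cf) cD).
Qed.

(* A maximum point p of |f|^2 (1 + e |z|^2) is a strict local maximum point of
   |f(z) (1 + e z conj(p))|, by Cauchy-Schwarz for the vectors (1, sqrt e z)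
   and (1, sqrt e p); large powers then contradict the weak principle. *)
Lemma maximum_principle (R : realType) (Om K : set (Cplx R))
    (f : Cplx R -> Cplx R) (B m : R) :
  open Om -> (forall z, Om z -> cabs z <= B) -> compact K -> K `<=` Om ->
  (forall z, Om z -> hol f z) -> 0 <= m ->
  (forall z, Om z -> ~ K z -> cabs (f z) <= m) ->
  forall z, Om z -> cabs (f z) <= m.
Proof.
move=> oO OB cK KO hf m0 fm z0 Oz0; rewrite leNgt; apply/negP => fz0.
have Kz0 : K z0.
  by apply: contrapT => nK; have := fm _ Oz0 nK; rewrite leNgt fz0.
have B0 : 0 <= B := le_trans (cabs_ge0 _ _) (OB _ Oz0).
pose dl := cabs (f z0) ^+ 2 - m ^+ 2.
have dl0 : 0 < dl by rewrite /dl subr_gt0 ltr_pXn2r ?nnegrE ?cabs_ge0.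
have Bm : 0 <= B ^+ 2 * m ^+ 2 by rewrite mulr_ge0 ?sqr_ge0.
(* With this e one has m^2 (1 + e B^2) < |f(z0)|^2, so the weight cannot lift the values outside [K]
   above the one at [z0]. The summand 1 covers the case B m = 0. *)
pose e := dl / (B ^+ 2 * m ^+ 2 + 1).
have Bm1 : 0 < B ^+ 2 * m ^+ 2 + 1 by lra.
have e0 : 0 < e by rewrite divr_gt0.
have edl : e * (B ^+ 2 * m ^+ 2 + 1) = dl by rewrite /e divfK // gt_eqF.
pose phi z := cabs (f z) ^+ 2 * (1 + e * cabs z ^+ 2).
have w1 z : 1 <= 1 + e * cabs z ^+ 2.
  by rewrite lerDl mulr_ge0 ?sqr_ge0 // ltW.
have [p Kp pmax] : exists2 p, K p & forall z, K z -> phi z <= phi p.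
  have [||c] := compact_EVT_max _ cK (f := phi); first by exists z0.
    apply: continuous_in_subspaceT => z; rewrite inE => Kz.
    exact/cabs_sqr_weight_continuous/hf/KO.
  rewrite inE => Kc hc; exists c => // z Kz; apply: hc; exact: mem_set.
have phiz0 : cabs (f z0) ^+ 2 <= phi z0.
  by rewrite /phi ler_peMr ?sqr_ge0.
have {}pmax z : Om z -> phi z <= phi p.
  move=> Oz; have [Kz|nKz] := pselect (K z); first exact: pmax.
  apply: le_trans (pmax _ Kz0); apply: le_trans phiz0.
  have h1 : cabs (f z) ^+ 2 <= m ^+ 2.
    by rewrite ler_pXn2r ?nnegrE ?cabs_ge0 //; exact: fm.
  have h2 : cabs z ^+ 2 <= B ^+ 2.
    by rewrite ler_pXn2r ?nnegrE ?cabs_ge0 //; exact: OB.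
  have h3 : e * cabs z ^+ 2 <= e * B ^+ 2 by rewrite ler_pM2l.
  apply: le_trans (_ : m ^+ 2 * (1 + e * B ^+ 2) <= _).
    apply: ler_pM => //; rewrite ?sqr_ge0 ?lerD2l //.
    by apply: le_trans (w1 z).
  have -> : m ^+ 2 * (1 + e * B ^+ 2) = m ^+ 2 + e * (B ^+ 2 * m ^+ 2) by ring.
  have : cabs (f z0) ^+ 2 = m ^+ 2 + dl by rewrite /dl; ring.
  lra.
have fp0 : 0 < phi p.
  apply: lt_le_trans (pmax _ Oz0); apply: lt_le_trans phiz0.
  by rewrite exprn_gt0 //; exact: le_lt_trans fz0.
have [r r0 hr] := open_discP _ _ _ oO (KO _ Kp).
pose s := r / 3; have s0 : 0 < s by rewrite divr_gt0.
have sO w : cabs (w - p) <= 2 * s -> Om w.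
  by move=> h; apply: hr; apply: le_lt_trans h _; rewrite /s; lra.
pose q := mkC (e * cre p) (- (e * cim p)).
pose G z := f z * (1 + z * q).
have hG z : Om z -> hol G z.
  move=> Oz; apply: holM; first exact: hf.
  by apply: holD; [exact: holC|apply: holM; [exact: holX|exact: holC]].
have G2 z : cabs (G z) ^+ 2 = cabs (f z) ^+ 2 *
    ((1 + e * cabs z ^+ 2) * (1 + e * cabs p ^+ 2) - e * cabs (z - p) ^+ 2).
  by rewrite /G cabsM exprMn sqr_cabs_kernel.
have Gp : cabs (G p) ^+ 2 = phi p * (1 + e * cabs p ^+ 2).
  by rewrite G2 subrr cabs0 /phi; ring.
pose W := (1 + e * B ^+ 2) ^+ 2.
have W1 : 1 <= 1 + e * B ^+ 2 by rewrite lerDl mulr_ge0 ?sqr_ge0 // ltW.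
have W0 : 0 < W by rewrite exprn_gt0 //; lra.
(* On the annulus [sqr_cabs_kernel] lowers the product of the two weights, which is at most [W], by
   at least e s^2, hence multiplies it by at most [th]. *)
pose th := 1 - e * s ^+ 2 / W.
have th1 : th < 1 by rewrite /th ltrBlDr ltrDl divr_gt0 // mulr_gt0 // exprn_gt0.
have key z : s <= cabs (z - p) <= 2 * s ->
    cabs (G z) ^+ 2 <= th * cabs (G p) ^+ 2.
  move=> /andP[zs1 zs2]; have Oz := sO _ zs2.
  have bz : 1 + e * cabs z ^+ 2 <= 1 + e * B ^+ 2.
    by rewrite lerD2l ler_pM2l // ler_pXn2r ?nnegrE ?cabs_ge0 //; exact: OB.
  have bp : 1 + e * cabs p ^+ 2 <= 1 + e * B ^+ 2.
    by rewrite lerD2l ler_pM2l // ler_pXn2r ?nnegrE ?cabs_ge0 //; exact: OB (KO _ Kp).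
  have A1 := w1 z; have A2 := w1 p.
  have : (1 + e * cabs z ^+ 2) * (1 + e * cabs p ^+ 2) <= W.
    by rewrite /W expr2; apply: ler_pM => //; lra.
  have : e * s ^+ 2 <= e * cabs (z - p) ^+ 2.
    by rewrite ler_pM2l // ler_pXn2r ?nnegrE ?cabs_ge0 // ltW.
  have pz := pmax _ Oz.
  have h0 : 0 <= (1 + e * cabs z ^+ 2) * (1 + e * cabs p ^+ 2) -
      e * cabs (z - p) ^+ 2 by rewrite -sqr_cabs_kernel sqr_ge0.
  rewrite Gp G2; rewrite /phi in pz *.
  move: (1 + e * cabs z ^+ 2) A1 pz bz h0 => x A1 pz bz h0.
  move: (1 + e * cabs p ^+ 2) A2 pz bp h0 => y A2 pz bp h0 h2 h1.
  have xy0 : 0 < x * y by rewrite mulr_gt0 //; lra.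
  have h3 : x * y - e * cabs (z - p) ^+ 2 <= th * (x * y).
    have : e * s ^+ 2 / W * (x * y) <= e * s ^+ 2.
      rewrite mulrAC ler_pdivrMr // ler_wpM2l // mulr_ge0 ?sqr_ge0 // ltW //.
    by rewrite /th mulrBl mul1r; lra.
  apply: le_trans (ler_wpM2l (sqr_ge0 _) h3) _.
  have th0 : 0 <= th.
    have : e * s ^+ 2 <= W by lra.
    by rewrite /th subr_ge0 ler_pdivrMr // mul1r.
  have -> : cabs (f z) ^+ 2 * (th * (x * y)) = th * y * (cabs (f z) ^+ 2 * x) by ring.
  have -> : th * (cabs (f p) ^+ 2 * y * y) = th * y * (cabs (f p) ^+ 2 * y) by ring.
  by rewrite ler_wpM2l // mulr_ge0 //; lra.
have ps : cabs (p + mkC s 0 - p) = s by rewrite addrC addKr cabs_real gtr0_norm.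
have b0 : 0 <= th * cabs (G p) ^+ 2.
  apply: le_trans (sqr_ge0 _) (key (p + mkC s 0) _).
  by rewrite ps lexx; lra.
(* Even powers of [G] express the estimate in squared moduli. Removing the factor 2 leaves |G(p)|^2
   <= th |G(p)|^2, with th < 1 and G(p) nonzero. *)
have /power_trick : forall n,
    (cabs (G p) ^+ 2) ^+ n <= 2 * (th * cabs (G p) ^+ 2) ^+ n.
  move=> n; rewrite -exprM -cabsX.
  apply: (weak_maximum _ (fun z => G z ^+ (2 * n)) p s) => // z zs.
    by apply: hol_pow; apply/hG/sO.
  by rewrite cabsX exprM; apply: lerXn2r; rewrite ?nnegrE ?sqr_ge0 // key.
move=> /(_ b0); rewrite Gp.
have : 0 < phi p * (1 + e * cabs p ^+ 2).
  by rewrite mulr_gt0 //; apply: lt_le_trans (w1 p).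
nra.
Qed.

Definition disc (R : realType) (a : Cplx R) (r : R) : set (Cplx R) :=
  [set z | cabs (z - a) < r].

Arguments disc {R}.

Lemma openCP (R : realType) (A : set (Cplx R)) :
  (forall z, A z -> exists2 r : R, 0 < r & forall w, cabs (w - z) < r -> A w) ->
  open A.
Proof. by move=> h; rewrite openE => z /h ?; apply/nbhsCP. Qed.

Lemma open_disc (R : realType) (a : Cplx R) (r : R) : open (disc a r).
Proof.
apply: openCP => z za; exists (r - cabs (z - a)) => [|w wz].
  by rewrite subr_gt0.
by apply: le_lt_trans (cabs_trans _ w z a) _; rewrite -ltrBrDr.
Qed.

Lemma disc_bounded (R : realType) (a : Cplx R) (r : R) z :
  disc a r z -> cabs z <= cabs a + r.
Proof.
move=> za; have -> : z = a + (z - a) by ring.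
by apply: le_trans (cabsD _ _ _) _; rewrite lerD2l; exact: ltW.
Qed.

Definition puncture (R : realType) (S : seq (Cplx R)) (z : Cplx R) : Cplx R :=
  \prod_(s <- S) (z - s) ^+ 2.

Arguments puncture {R}.

Lemma puncture_eq0 (R : realType) (S : seq (Cplx R)) z :
  (puncture S z == 0) = (z \in S).
Proof.
rewrite /puncture prodf_seq_eq0.
apply/hasP/idP => [[s sS] /= |zS].
  by rewrite expf_eq0 /= subr_eq0 => /eqP ->.
by exists z => //=; rewrite subrr expr0n.
Qed.

Lemma puncture_le (R : realType) (S : seq (Cplx R)) (A : R) z :
  (forall s, s \in S -> cabs (z - s) <= A) ->
  cabs (puncture S z) <= \prod_(s <- S) A ^+ 2.
Proof.
move=> h; rewrite /puncture cabs_prod big_seq [leRHS]big_seq.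
apply: ler_prod => s sS; rewrite cabsX sqr_ge0 /=.
rewrite ler_pXn2r ?nnegrE ?cabs_ge0 ?h //.
exact: le_trans (cabs_ge0 _ _) (h s sS).
Qed.

Lemma hol_puncture (R : realType) (S : seq (Cplx R)) z : hol (puncture S) z.
Proof.
apply: hol_prod => s _; apply: hol_pow.
by apply: holB; [exact: holX|exact: holC].
Qed.

(* A bounded singularity at s is killed by the factor (z - s)^2; this factor
   disappears from the estimate when f is replaced by a large power. *)
Lemma maximum_punctured (R : realType) (Om K : set (Cplx R))
    (S : seq (Cplx R)) (f : Cplx R -> Cplx R) (B B' m : R) :
  open Om -> (forall z, Om z -> cabs z <= B) -> compact K -> K `<=` Om ->
  (forall z, Om z -> z \notin S -> hol f z) ->
  (forall z, Om z -> z \notin S -> cabs (f z) <= B') -> 0 <= m ->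
  (forall z, Om z -> z \notin S -> ~ K z -> cabs (f z) <= m) ->
  forall z, Om z -> z \notin S -> cabs (f z) <= m.
Proof.
move=> oO OB cK KO hf fB m0 fm z Oz zS.
pose A := B + \sum_(s <- S) cabs s.
have hA w s : Om w -> s \in S -> cabs (w - s) <= A.
  move=> Ow sS; apply: le_trans (cabsB _ _ _) _; apply: lerD; first exact: OB.
  rewrite (big_rem s) //= lerDl sumr_ge0 // => i _; exact: cabs_ge0.
have qz : puncture S z != 0 by rewrite puncture_eq0.
have B'0 : 0 <= B' := le_trans (cabs_ge0 _ _) (fB _ Oz zS).
have hF n w : Om w -> hol (fun v => puncture S v * f v ^+ n) w.
  move=> Ow; have [wS|wS] := boolP (w \in S); last first.
    by apply: holM; [exact: hol_puncture|apply: hol_pow; exact: hf].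
  (* At a puncture the product is O(|v - w|^2), so its derivative is 0 whatever value f takes
     there. *)
  apply/holP; exists 0 => e e0.
  have [r r0 hr] := open_discP _ _ _ oO Ow.
  pose D := \prod_(s <- rem w S) A ^+ 2.
  have D0 : 0 <= D by apply: prodr_ge0 => i _; exact: sqr_ge0.
  have DB : 0 <= D * B' ^+ n by rewrite mulr_ge0 // exprn_ge0.
  have DB1 : 0 < D * B' ^+ n + 1 by lra.
  exists (Num.min r (e / (D * B' ^+ n + 1))).
    by rewrite lt_min r0 divr_gt0.
  move=> v; rewrite lt_min => /andP[vr ve].
  have qw : puncture S w = 0 by apply/eqP; rewrite puncture_eq0.
  rewrite qw mul0r subr0 mul0r subr0.
  have [vS|vS] := boolP (v \in S).
    have -> : puncture S v = 0 by apply/eqP; rewrite puncture_eq0.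
    by rewrite mul0r cabs0 mulr_ge0 ?cabs_ge0 // ltW.
  have Ov := hr _ vr.
  have -> : puncture S v = (v - w) ^+ 2 * puncture (rem w S) v.
    by rewrite /puncture (big_rem w).
  have -> : cabs ((v - w) ^+ 2 * puncture (rem w S) v * f v ^+ n) =
      cabs (v - w) * (cabs (v - w) *
        (cabs (puncture (rem w S) v) * cabs (f v) ^+ n)).
    by rewrite expr2 !cabsM cabsX; ring.
  have h1 : cabs (puncture (rem w S) v) <= D.
    by apply: puncture_le => s /mem_rem sS; exact: hA.
  have h2 : cabs (f v) ^+ n <= B' ^+ n.
    by apply: lerXn2r; rewrite ?nnegrE ?cabs_ge0 //; exact: fB.
  have h3 : cabs (puncture (rem w S) v) * cabs (f v) ^+ n <= D * B' ^+ n.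
    by apply: ler_pM => //; rewrite ?exprn_ge0 ?cabs_ge0.
  rewrite [e * _]mulrC; apply: ler_wpM2l.
    exact: cabs_ge0.
  rewrite ltr_pdivlMr // in ve; apply: le_trans (ltW ve).
  by apply: ler_wpM2l; [exact: cabs_ge0|lra].
pose Q := \prod_(s <- S) A ^+ 2.
have Q0 : 0 <= Q by apply: prodr_ge0 => i _; exact: sqr_ge0.
have key n : cabs (puncture S z * f z ^+ n) <= Q * m ^+ n.
  apply: (maximum_principle _ Om K (fun v => puncture S v * f v ^+ n) B
    (Q * m ^+ n) oO OB cK KO (hF n)) => //.
    by rewrite mulr_ge0 // exprn_ge0.
  move=> w Ow Kw; have [wS|wS] := boolP (w \in S).
    have -> : puncture S w = 0 by apply/eqP; rewrite puncture_eq0.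
    by rewrite mul0r cabs0 mulr_ge0 // exprn_ge0.
  rewrite cabsM cabsX; apply: ler_pM; rewrite ?exprn_ge0 ?cabs_ge0 //.
    by apply: puncture_le => s sS; exact: hA.
  by apply: lerXn2r; rewrite ?nnegrE ?cabs_ge0 //; exact: fm.
have qz0 : 0 < cabs (puncture S z) by rewrite cabs_gt0.
apply: (power_trick _ _ _ (Q / cabs (puncture S z)) m0) => n.
rewrite mulrAC ler_pdivlMr // mulrC -cabsX -cabsM; exact: key.
Qed.

(** The difference quotient obeys the maximum principle once b joins the punctures. Outside the disc
    of radius r / 2 one has |z - b| >= 7 r / 16, and 2 M divided by this is 32 M / (7 r), less than
    5 M / r if M > 0. At z = b the quotient is 0 by the convention on inverses. *)
Lemma schwarz (R : realType) (a : Cplx R) (r M : R) (S : seq (Cplx R))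
    (g : Cplx R -> Cplx R) (b : Cplx R) :
  0 < r ->
  (forall z, disc a r z -> z \notin S -> hol g z) ->
  (forall z, disc a r z -> z \notin S -> cabs (g z) <= M) ->
  cabs (b - a) <= r / 16 -> b \notin S ->
  forall z, disc a r z -> z \notin S ->
  cabs ((g z - g b) / (z - b)) <= 5 * M / r.
Proof.
move=> r0 hg gM ba bS.
have ab : disc a r b by rewrite /disc /=; apply: le_lt_trans ba _; lra.
have M0 : 0 <= M := le_trans (cabs_ge0 _ _) (gM _ ab bS).
have [L hL] := (holP _ _ _).1 (hg _ ab bS).
have [d d0 hd] := hL 1 ltr01.
pose k z := (g z - g b) / (z - b).
have Mr0 : 0 <= 5 * M / r by rewrite divr_ge0 ?mulr_ge0 // ltW.
have gg z : disc a r z -> z \notin S -> cabs (g z - g b) <= 2 * M.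
  move=> za zS; apply: le_trans (cabsB _ _ _) _.
  have := gM _ za zS; have := gM _ ab bS; lra.
have K : forall z, disc a r z -> z \notin b :: S -> cabs (k z) <= 5 * M / r.
  apply: (maximum_punctured _ _ [set z | cabs (z - a) <= r / 2] _ _
    (cabs a + r) (1 + cabs L + 2 * M / d) _ (open_disc _ a r)
    (disc_bounded _ a r) (compact_disc _ a _)) => //.
  - by move=> z /= za; rewrite /disc /=; apply: le_lt_trans za _; lra.
  - move=> z za; rewrite inE negb_or => /andP[zb zS].
    apply: holM; first by apply: holB; [exact: hg|exact: holC].
    apply: holV; first by rewrite subr_eq0.
    by apply: holB; [exact: holX|exact: holC].
  - move=> z za; rewrite inE negb_or => /andP[zb zS].
    have czb : 0 < cabs (z - b) by rewrite cabs_gt0 subr_eq0.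
    rewrite /k cabsM cabsV ler_pdivrMr //.
    have [zd|zd] := ltP (cabs (z - b)) d.
      have -> : g z - g b = (g z - g b - L * (z - b)) + L * (z - b) by ring.
      apply: le_trans (cabsD _ _ _) _; rewrite cabsM.
      have := hd z zd; rewrite mul1r.
      have : 0 <= 2 * M / d * cabs (z - b).
        by rewrite mulr_ge0 ?cabs_ge0 // divr_ge0 ?mulr_ge0 // ltW.
      lra.
    apply: le_trans (gg _ za zS) _.
    have : 2 * M <= 2 * M / d * cabs (z - b).
      by rewrite mulrAC ler_pdivlMr // ler_wpM2l // mulr_ge0.
    have : 0 <= (1 + cabs L) * cabs (z - b).
      by rewrite mulr_ge0 ?cabs_ge0 // addr_ge0 ?cabs_ge0.
    lra.
  - move=> z za; rewrite inE negb_or => /andP[zb zS] /negP.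
    rewrite -ltNge => zr.
    have czb : 0 < cabs (z - b) by rewrite cabs_gt0 subr_eq0.
    have zbr : 7 * r / 16 <= cabs (z - b).
      have := cabs_trans _ z b a; lra.
    rewrite /k cabsM cabsV ler_pdivrMr //; apply: le_trans (gg _ za zS) _.
    apply: le_trans (ler_wpM2l Mr0 zbr).
    have -> : 5 * M / r * (7 * r / 16) = 35 / 16 * M by field; rewrite gt_eqF.
    lra.
move=> z za zS; have [->|zb] := eqVneq z b.
  by rewrite !subrr mul0r cabs0.
by apply: K => //; rewrite inE negb_or zb.
Qed.

(** * Identity theorem and Hurwitz's theorem *)

(** A general filter serves both purposes: an ultrafilter at the boundary for Hurwitz's theorem, and
    the trivial filter, for which a constant family tends to 0 only if it is 0, for the identity
    theorem. *)
Definition tends0 (R : realType) (I : Type) (F : set_system I)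
    (u : I -> Cplx R) : Prop :=
  forall e : R, 0 < e -> F [set x | cabs (u x) < e].

Arguments tends0 {R I}.

Lemma geom_small (R : realType) (q M e : R) :
  0 <= q -> q < 1 -> 0 < e -> exists n, M * q ^+ n < e.
Proof.
move=> q0 q1 e0; apply: contrapT => /forallNP H.
have h n : e <= M * q ^+ n by rewrite leNgt; apply/negP; exact: H.
suff : (1 : R) <= q by rewrite leNgt q1.
apply: (power_trick _ _ _ (M / e) q0) => n.
by rewrite expr1n mulrAC ler_pdivlMr // mul1r.
Qed.

(* Dividing out one zero at a time gains a factor 5/8 on the smaller disc. *)
Lemma many_zeros (R : realType) (I : Type) (F : set_system I)
    (FF : Filter F) (a : Cplx R) (r : R) : 0 < r ->
  forall (bs S : seq (Cplx R)) (M : R) (g : I -> Cplx R -> Cplx R),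
  uniq bs -> 0 <= M ->
  (forall b, b \in bs -> cabs (b - a) <= r / 16 /\ b \notin S) ->
  F [set x | forall z, disc a r z -> z \notin S ->
       hol (g x) z /\ cabs (g x z) <= M] ->
  (forall b, b \in bs -> tends0 F (fun x => g x b)) ->
  forall c, cabs (c - a) <= r / 16 -> c \notin S ->
  forall e : R, 0 < e ->
  F [set x | cabs (g x c) <= M * (5 / 8) ^+ size bs + e].
Proof.
move=> r0; elim=> [|b bs IH] S M g.
  move=> _ M0 _ Fg _ c ca cS e e0; apply: filterS Fg => x /= h.
  rewrite expr0 mulr1; have [|_] := h c _ cS.
    by rewrite /disc /=; apply: le_lt_trans ca _; lra.
  by move/le_trans; apply; rewrite lerDl ltW.
move=> /= /andP[bbs ubs] M0 hb Fg gb c ca cS e e0.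
have [ba bS] := hb b (mem_head _ _).
have gb0 := gb b (mem_head _ _).
have Mn : 0 <= M * (5 / 8) ^+ (size bs).+1 by rewrite mulr_ge0 // exprn_ge0.
have [->|cb] := eqVneq c b.
  by apply: filterS (gb0 e e0) => x /= /ltW h; apply: le_trans h _; rewrite lerDr.
pose k x z := (g x z - g x b) / (z - b).
have M'0 : 0 <= 5 * M / r by rewrite divr_ge0 ?mulr_ge0 // ltW.
have e' : 0 < 4 * e / r by rewrite divr_gt0 // mulr_gt0.
have Fk : F [set x | forall z, disc a r z -> z \notin b :: S ->
    hol (k x) z /\ cabs (k x z) <= 5 * M / r].
  apply: filterS Fg => x /= h z za; rewrite inE negb_or => /andP[zb zS].
  have hg w : disc a r w -> w \notin S -> hol (g x) w.
    by move=> wa wS; have [] := h w wa wS.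
  have gM w : disc a r w -> w \notin S -> cabs (g x w) <= M.
    by move=> wa wS; have [] := h w wa wS.
  split; last exact: (schwarz _ a r M S (g x) b r0 hg gM ba bS z za zS).
  apply: holM; first by apply: holB; [exact: hg|exact: holC].
  apply: holV; first by rewrite subr_eq0.
  by apply: holB; [exact: holX|exact: holC].
have kb b' : b' \in bs -> tends0 F (fun x => k x b').
  move=> b'b d d0.
  have bb' : 0 < cabs (b' - b).
    by rewrite cabs_gt0 subr_eq0; apply: contraNneq bbs => <-.
  have d2 : 0 < d * cabs (b' - b) / 2 by rewrite divr_gt0 // mulr_gt0.
  have b'bs : b' \in b :: bs by rewrite inE b'b orbT.
  apply: filterS2 (gb0 _ d2) (gb _ b'bs _ d2) => x /= h1 h2.
  rewrite /k cabsM cabsV ltr_pdivrMr //.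
  by apply: le_lt_trans (cabsB _ _ _) _; lra.
have hb' b' : b' \in bs -> cabs (b' - a) <= r / 16 /\ b' \notin b :: S.
  move=> b'b; have [|h1 h2] := hb b'; first by rewrite inE b'b orbT.
  split=> //; rewrite inE negb_or h2 andbT.
  by apply: contraNneq bbs => <-.
have cS' : c \notin b :: S by rewrite inE negb_or cb.
have e2 : 0 < e / 2 by rewrite divr_gt0.
have := IH (b :: S) (5 * M / r) k ubs M'0 hb' Fk kb c ca cS' _ e'.
apply: filterS2 (gb0 _ e2) => x /= h1 h2.
(* Multiplied by the bound 5 M / r of [schwarz], this distance gives the factor 5 / 8; it also turns
   the error 4 e / r into e / 2. *)
have cbr : cabs (c - b) <= r / 8.
  have := cabs_trans _ c a b; rewrite (cabsC _ a b); lra.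
have cb0 : c - b != 0 by rewrite subr_eq0.
have -> : g x c = g x b + (c - b) * k x c by rewrite /k; field.
apply: le_trans (cabsD _ _ _) _; rewrite cabsM.
have h3 : cabs (c - b) * cabs (k x c) <=
    r / 8 * (5 * M / r * (5 / 8) ^+ size bs + 4 * e / r).
  by apply: ler_pM => //; exact: cabs_ge0.
have E : r / 8 * (5 * M / r * (5 / 8) ^+ size bs + 4 * e / r) =
    M * (5 / 8) ^+ (size bs).+1 + e / 2.
  by rewrite exprS; field; rewrite gt_eqF.
rewrite E in h3; lra.
Qed.

(** The factor (5 / 8)^n of [many_zeros] is made arbitrarily small. The zeros are asymptotic ones,
    and no accumulation point has to be located: they only have to lie in the smaller disc. *)
Lemma infinitely_many_zeros (R : realType) (I : Type) (F : set_system I)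
    (FF : Filter F) (a : Cplx R) (r M : R) (g : I -> Cplx R -> Cplx R)
    (zeta : nat -> Cplx R) :
  0 < r -> 0 <= M ->
  F [set x | forall z, disc a r z -> hol (g x) z /\ cabs (g x z) <= M] ->
  injective zeta -> (forall n, cabs (zeta n - a) <= r / 16) ->
  (forall n, tends0 F (fun x => g x (zeta n))) ->
  forall c, cabs (c - a) <= r / 16 -> tends0 F (fun x => g x c).
Proof.
move=> r0 M0 Fg zi za z0 c ca e e0.
have e2 : 0 < e / 2 by rewrite divr_gt0.
have [||n hn] := geom_small _ (5 / 8) M _ _ _ e2; [lra|lra|].
have := many_zeros R I F FF a r r0 (map zeta (iota 0 n)) [::] M g.
rewrite map_inj_uniq // iota_uniq size_map size_iota.
move=> /(_ isT M0) /(_ _ _ _ c ca isT _ e2) H.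
have {}H : F [set x | cabs (g x c) <= M * (5 / 8) ^+ n + e / 2].
  apply: H.
  - by move=> b /mapP[i _ ->]; rewrite in_nil.
  - by apply: filterS Fg => x h z zd _; exact: h.
  - by move=> b /mapP[i _ ->].
by apply: filterS H => x /= h; apply: le_lt_trans h _; lra.
Qed.

(** The local equivalence makes both [T] and its negation open in U, and U is connected. *)
Lemma domain_chain (R : realType) (U : set (Cplx R)) (T : Cplx R -> Prop) :
  open U -> connected U ->
  (forall a, U a -> exists2 d : R, 0 < d &
     forall c, cabs (c - a) < d -> (T a <-> T c)) ->
  forall a b, U a -> U b -> T a -> T b.
Proof.
move=> oU cU loc a b Ua Ub Ta.
suff : U `&` [set c | T c] = U by move/seteqP => [_ /(_ b Ub)[]].
have opn (T' : Cplx R -> Prop) : (forall x, U x -> exists2 d : R, 0 < d &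
     forall c, cabs (c - x) < d -> (T' x -> T' c)) -> open (U `&` [set c | T' c]).
  move=> h; apply: openCP => x [Ux /= Tx].
  have [d d0 hd] := h x Ux; have [r r0 hr] := open_discP _ _ _ oU Ux.
  exists (Num.min d r); first by rewrite lt_min d0 r0.
  by move=> w; rewrite lt_min => /andP[wd wr]; split; [exact: hr|exact: (hd w wd)].
apply: cU.
- by exists a.
- exists (U `&` [set c | T c]); last by rewrite setIA setIid.
  by apply: opn => x /loc[d d0 hd]; exists d => // c /hd[].
- exists (~` (U `&` [set c | ~ T c])).
    apply: open_closedC; apply: opn => x /loc[d d0 hd]; exists d => // c /hd.
    by move=> [h1 h2] nT Tc; apply: nT; exact: h2.
  apply/seteqP; split=> x [Ux h]; split=> //; first by move=> [_].
  by apply: contrapT => nT; apply: h.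
Qed.

Lemma hol_local_bound (R : realType) (U : set (Cplx R)) (f : Cplx R -> Cplx R)
    (a : Cplx R) :
  open U -> (forall z, U z -> hol f z) -> U a ->
  exists r M : R, [/\ 0 < r, 0 <= M, disc a r `<=` U &
    forall z, disc a r z -> cabs (f z) <= M].
Proof.
move=> oU hf Ua.
have [d d0 hd] := (continuousCP _ _ _).1 (hol_continuous _ _ _ (hf _ Ua)) 1 ltr01.
have [r r0 hr] := open_discP _ _ _ oU Ua.
exists (Num.min d r), (1 + cabs (f a)); split.
- by rewrite lt_min d0 r0.
- by rewrite addr_ge0 // cabs_ge0.
- by move=> z; rewrite /disc /= lt_min => /andP[_ /hr].
- move=> z; rewrite /disc /= lt_min => /andP[/hd h _].
  have -> : f z = (f z - f a) + f a by ring.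
  by apply: le_trans (cabsD _ _ _) _; rewrite lerD2r ltW.
Qed.

Lemma cvg_zero_const (R : realType) (u : Cplx R) :
  (forall e : R, 0 < e -> cabs u < e) -> u = 0.
Proof.
move=> h; apply/eqP; rewrite -cabs_eq0; apply/eqP.
apply/le_anti; rewrite cabs_ge0 andbT leNgt; apply/negP => u0.
by have := h _ u0; rewrite ltxx.
Qed.

Lemma identity_theorem (R : realType) (U : set (Cplx R))
    (f : Cplx R -> Cplx R) (p : Cplx R) (d : R) :
  open U -> connected U -> (forall z, U z -> hol f z) -> U p -> 0 < d ->
  (forall z, cabs (z - p) < d -> f z = 0) -> forall z, U z -> f z = 0.
Proof.
move=> oU cU hf Up d0 fp z Uz.
pose T a := exists2 d : R, 0 < d & forall z, cabs (z - a) < d -> f z = 0.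
suff [e e0] : T z by apply; rewrite subrr cabs0.
have loc a r M c : 0 < r -> 0 <= M -> disc a r `<=` U ->
    (forall z, disc a r z -> cabs (f z) <= M) -> cabs (c - a) < r / 32 ->
    T c -> forall w, cabs (w - a) <= r / 16 -> f w = 0.
  move=> r0 M0 aU fM ca [e e0 fe] w wa.
  pose t := Num.min (e / 2) (r / 64).
  have t0 : 0 < t by rewrite lt_min !divr_gt0.
  pose zeta n := c + mkC (t / (n.+1)%:R) 0.
  have n0 n : 0 < (n.+1)%:R :> R by rewrite ltr0n.
  have tn n : t / (n.+1)%:R <= t.
    by rewrite ler_pdivrMr // ler_peMr ?(ltW t0) // ler1n.
  have zc n : cabs (zeta n - c) <= t.
    by rewrite /zeta addrC addKr cabs_real ger0_norm // ltW // divr_gt0.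
  have te : t <= e / 2 by rewrite ge_min lexx.
  have tr : t <= r / 64 by rewrite ge_min lexx orbT.
  apply: cvg_zero_const => e' e'0.
  (* A constant family indexed by [unit] along the trivial filter: [tends0] then means vanishing.
     The points c + t / (n + 1) all lie in the disc where f is known to vanish. *)
  have := infinitely_many_zeros R unit [set setT] _ a r M (fun=> f) zeta r0 M0.
  have FF : Filter [set setT : set unit].
    split=> //.
      by move=> P Q /= -> ->; rewrite setIid.
    by move=> P Q PQ /= PT; rewrite PT in PQ; apply/seteqP; split.
  move=> /(_ FF) H.
  have {}H : tends0 [set setT : set unit] (fun=> f w).
    apply: H => //.
    - by apply/seteqP; split=> // x _ z' az; split; [exact/hf/aU|exact: fM].
    - move=> i j /addrI; rewrite /mkC => -[] /(mulfI (lt0r_neq0 t0)) /invr_inj.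
      by move=> /eqP; rewrite eqr_nat => /eqP[].
    - move=> n; have := cabs_trans _ (zeta n) c a; have := zc n; lra.
    - move=> n e1 e10 /=; apply/seteqP; split=> // x _ /=.
      by rewrite fe ?cabs0 //; apply: le_lt_trans (zc n) _; lra.
  have /= := H e' e'0; move/seteqP => [_ /(_ tt Logic.I)]; exact.
apply: (domain_chain R U T oU cU _ p z Up Uz); last by exists d.
move=> a Ua; have [r [M [r0 M0 aU fM]]] := hol_local_bound _ _ _ _ oU hf Ua.
exists (r / 64) => [|c ca]; first by rewrite divr_gt0.
have r2 : 0 < r / 2 by rewrite divr_gt0.
have cU' : disc c (r / 2) `<=` disc a r.
  by move=> w; rewrite /disc /= => wc; have := cabs_trans _ w c a; lra.
split=> Tx.
  (* The disc of radius r / 2 about c lies in the one of radius r about a, so the roles of a and c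
     can be exchanged. *)
  have h := loc c (r / 2) M a r2 M0 (subset_trans cU' aU).
  exists (r / 32) => [|w wc]; first by rewrite divr_gt0.
  apply: h => //; first by move=> w' /cU'; exact: fM.
  - by rewrite cabsC; apply: lt_le_trans ca _; lra.
  - by apply: le_trans (ltW wc) _; lra.
exists (r / 16) => [|w wa]; first by rewrite divr_gt0.
apply: (loc a r M c) => //; last exact: ltW.
by apply: lt_le_trans ca _; lra.
Qed.

(** Holomorphic functions on a domain have no zero divisors: otherwise f would vanish on a disc
    about q where g does not. *)
Lemma common_nonzero (R : realType) (U : set (Cplx R))
    (f g : Cplx R -> Cplx R) (p q : Cplx R) :
  open U -> connected U -> (forall z, U z -> hol f z) ->
  (forall z, U z -> hol g z) -> U p -> f p != 0 -> U q -> g q != 0 ->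
  exists z, [/\ U z, f z != 0 & g z != 0].
Proof.
move=> oU cU hf hg Up fp Uq gq.
have gq0 : 0 < cabs (g q) by rewrite cabs_gt0.
have [d d0 hd] :=
  (continuousCP _ _ _).1 (hol_continuous _ _ _ (hg _ Uq)) _ gq0.
have [r r0 hr] := open_discP _ _ _ oU Uq.
have m0 : 0 < Num.min d r by rewrite lt_min d0 r0.
apply: contrapT => H; move/eqP: fp; apply.
apply: (identity_theorem R U f q _ oU cU hf Uq m0) => // w.
rewrite lt_min => /andP[/hd wd /hr Uw].
apply/eqP; apply: contrapT => /negP fw; apply: H; exists w; split=> //.
apply: contraTneq wd => ->.
by rewrite sub0r cabsN ltxx.
Qed.

Lemma compact_annulus (R : realType) (a : Cplx R) (s t : R) :
  compact [set z | s <= cabs (z - a) <= t].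
Proof.
apply: (subclosed_compact _ (compact_disc _ a t)); last by move=> z /andP[].
have -> : [set z | s <= cabs (z - a) <= t] =
    [set z | cabs (z - a) <= t] `&` (fun z => cabs (z - a)) @^-1` [set x | s <= x].
  by apply/seteqP; split=> z /= [] ; [move=> /andP[? ?]|move=> ? ?; apply/andP].
apply: closedI; first exact: closed_disc.
apply: preimage_closed; last exact: closed_ge.
by move=> z _; exact: cabs_continuous.
Qed.

Lemma tends0_le (R : realType) (I : Type) (F : set_system I) (FF : Filter F)
    (u v : I -> Cplx R) (C : R) :
  F [set x | cabs (v x) <= C * cabs (u x)] -> tends0 F u -> tends0 F v.
Proof.
move=> uv u0 e e0.
have C0 : 0 < `|C| + 1 by rewrite ltr_wpDl.
have e1 : 0 < e / (`|C| + 1) by rewrite divr_gt0.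
apply: filterS2 uv (u0 _ e1) => x /= h1; rewrite ltr_pdivlMr // => h2.
apply: le_lt_trans h1 _; apply: le_lt_trans h2.
rewrite mulrC ler_wpM2l ?cabs_ge0 //.
by have := ler_norm C; lra.
Qed.

(* Minimum principle: 1 / h is bounded by its values on the annulus. *)
Lemma annulus_small (R : realType) (h : Cplx R -> Cplx R) (a : Cplx R) (s : R) :
  0 < s -> (forall z, cabs (z - a) <= 2 * s -> hol h z /\ h z != 0) ->
  exists2 z, s <= cabs (z - a) <= 2 * s & cabs (h z) <= 3 * cabs (h a).
Proof.
move=> s0 hh; apply: contrapT => H.
have aa : cabs (a - a) <= 2 * s by rewrite subrr cabs0 mulr_ge0 // ltW.
have ha0 : 0 < cabs (h a) by rewrite cabs_gt0; have [] := hh a aa.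
(* The constant 3 exceeds the factor 2 of [weak_maximum], which makes this bound contradictory. *)
have : cabs (h a)^-1 <= 2 * (3 * cabs (h a))^-1.
  apply: (weak_maximum R (fun z => (h z)^-1) a s) => // z zs.
    by have [hz z0] := hh z zs; exact: holV.
  rewrite cabsV lef_pV2 ?posrE ?mulr_gt0 //.
    rewrite leNgt; apply/negP => hz; apply: H; exists z => //.
    exact: ltW.
  rewrite cabs_gt0; move/andP: zs => [_ zs]; have [_ hz] := hh z zs.
  exact: hz.
rewrite cabsV; have i0 : 0 < (cabs (h a))^-1 by rewrite invr_gt0.
have -> : 2 * (3 * cabs (h a))^-1 = 2 / 3 * (cabs (h a))^-1.
  by field; rewrite gt_eqF.
lra.
Qed.

Lemma lipschitz (R : realType) (a : Cplx R) (r M : R) (S : seq (Cplx R))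
    (g : Cplx R -> Cplx R) (b : Cplx R) :
  0 < r ->
  (forall z, disc a r z -> z \notin S -> hol g z) ->
  (forall z, disc a r z -> z \notin S -> cabs (g z) <= M) ->
  cabs (b - a) <= r / 16 -> b \notin S ->
  forall z, disc a r z -> z \notin S ->
  cabs (g z - g b) <= 5 * M / r * cabs (z - b).
Proof.
move=> r0 hg gM ba bS z za zS; have [->|zb] := eqVneq z b.
  by rewrite !subrr cabs0 mulr0.
have := schwarz R a r M S g b r0 hg gM ba bS z za zS.
by rewrite cabsM cabsV ler_pdivrMr // cabs_gt0 subr_eq0.
Qed.

(** Each annulus about a contains, by the minimum principle, points where h is small along with
    h(a). Infinitely many disjoint annuli then provide infinitely many asymptotic zeros. *)
Lemma hurwitz_local (R : realType) (I : Type) (F : set_system I)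
    (FU : UltraFilter F) (a : Cplx R) (r M : R) (h : I -> Cplx R -> Cplx R) :
  0 < r -> 0 <= M ->
  F [set x | forall z, disc a r z ->
     [/\ hol (h x) z, h x z != 0 & cabs (h x z) <= M]] ->
  tends0 F (fun x => h x a) ->
  forall c, cabs (c - a) <= r / 16 -> tends0 F (fun x => h x c).
Proof.
move=> r0 M0 Fh h0.
have PF : ProperFilter F by exact: ultra_proper.
have FF : Filter F by exact: filter_filter.
(* The ratio 4 keeps the annuli s n <= |z - a| <= 2 s n disjoint, and the factor r / 32 keeps them
   within radius r / 16. *)
pose s n : R := r / 32 / 4 ^+ n.
have s0 n : 0 < s n by rewrite !divr_gt0 // exprn_gt0.
have sS n : s n.+1 = s n / 4.
  by rewrite /s exprS; field; rewrite expf_neq0.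
have sle m n : (m <= n)%N -> s n <= s m.
  elim: n => [|n IH]; first by rewrite leqn0 => /eqP ->.
  rewrite leq_eqVlt => /orP[/eqP -> //|]; rewrite ltnS => /IH.
  by rewrite sS; have := s0 n; lra.
have s2 n : 2 * s n <= r / 16.
  by have := sle 0%N n isT; rewrite {2}/s expr0 divr1; lra.
clearbody s.
have Z n : exists z, s n <= cabs (z - a) <= 2 * s n /\ tends0 F (fun x => h x z).
  pose P x := forall z, disc a r z ->
    [/\ hol (h x) z, h x z != 0 & cabs (h x z) <= M].
  pose Q x w := P x ->
    s n <= cabs (w - a) <= 2 * s n /\ cabs (h x w) <= 3 * cabs (h x a).
  have Qex x : exists w, Q x w.
    have [hx|nhx] := pselect (P x); last by exists 0.
    have [z zs|z z1 z2] := annulus_small R (h x) a (s n) (s0 n).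
      have [] := hx z; first by rewrite /disc /=; have := s2 n; lra.
      by move=> h1 h2 _; split.
    by exists z => _; split.
  have [u hu] := choice Qex.
  (* The point found in the annulus depends on x, its limit z along [F] does not; the uniform
     Lipschitz bound carries the smallness over to z. *)
  have [z zs uz] := ultra_compact_cvg _ _ F u _ FU
    (compact_annulus R a (s n) (2 * s n)) (filterS (fun x hx => (hu x hx).1) Fh).
  exists z; split=> //.
  have za : cabs (z - a) <= r / 16.
    by move/andP: zs => [_ zs]; apply: le_trans zs (s2 n).
  have C0 : 0 <= 5 * M / r by rewrite divr_ge0 ?mulr_ge0 // ltW.
  move=> e e0.
  have e6 : 0 < e / 6 by rewrite divr_gt0.
  have e2 : 0 < e / (2 * (5 * M / r + 1)) by rewrite divr_gt0 // mulr_gt0 //; lra.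
  have uz' := (cvgCP _ _ F FF u z).1 uz _ e2.
  apply: filterS3 (h0 _ e6) uz' Fh => x /= h1 h2 h3.
  have [ux1 ux2] := hu x h3.
  have uxd : disc a r (u x).
    by rewrite /disc /=; move/andP: ux1 => [_ ux1]; have := s2 n; lra.
  have hx1 w : disc a r w -> w \notin [::] -> hol (h x) w by move=> /h3[].
  have hx2 w : disc a r w -> w \notin [::] -> cabs (h x w) <= M by move=> /h3[].
  have := lipschitz R a r M [::] (h x) z r0 hx1 hx2 za isT (u x) uxd isT.
  move: h2; rewrite ltr_pdivlMr ?mulr_gt0 //; last by lra.
  have := cabs_trans _ (h x z) (h x (u x)) 0.
  rewrite !subr0 (cabsC _ (h x z)).
  have := cabs_ge0 _ (u x - z); nra.
have [zeta hz] := choice Z.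
have inj_zeta : injective zeta.
  have lt_zeta m n : (m < n)%N -> zeta m != zeta n.
    move=> mn; apply/eqP => E.
    have [/andP[h1 _] _] := hz m; have [/andP[_ h2] _] := hz n.
    rewrite E in h1; have := sle m.+1 n mn; rewrite (sS m).
    by have := s0 m; lra.
  by move=> m n E; case: (ltngtP m n) => // /lt_zeta; rewrite E eqxx.
apply: (infinitely_many_zeros R I F _ a r M h zeta r0 M0 _ inj_zeta).
- by apply: filterS Fh => x /= hx z /hx[].
- by move=> n; have [/andP[_ hn] _] := hz n; apply: le_trans hn (s2 n).
- by move=> n; have [] := hz n.
Qed.

Lemma hurwitz (R : realType) (I : Type) (F : set_system I)
    (FU : UltraFilter F) (U : set (Cplx R)) (M : R) (h : I -> Cplx R -> Cplx R) :
  open U -> connected U -> 0 <= M ->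
  F [set x | forall z, U z ->
     [/\ hol (h x) z, h x z != 0 & cabs (h x z) <= M]] ->
  forall a b, U a -> U b ->
  tends0 F (fun x => h x a) -> tends0 F (fun x => h x b).
Proof.
move=> oU cU M0 Fh.
have PF : ProperFilter F by exact: ultra_proper.
have FF : Filter F by exact: filter_filter.
apply: (domain_chain R U (fun z => tends0 F (fun x => h x z)) oU cU) => a Ua.
have [r r0 hr] := open_discP _ _ _ oU Ua.
exists (r / 32) => [|c ca]; first by rewrite divr_gt0.
have r2 : 0 < r / 2 by rewrite divr_gt0.
split=> H.
  apply: (hurwitz_local R I F FU a r M h r0 M0 _ H).
    by apply: filterS Fh => x hx z /hr /hx.
  by apply: le_trans (ltW ca) _; lra.
apply: (hurwitz_local R I F FU c (r / 2) M h r2 M0 _ H).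
  apply: filterS Fh => x hx z zc; apply/hx/hr.
  by have := cabs_trans _ z c a; rewrite /disc /= in zc; lra.
by rewrite cabsC; apply: le_trans (ltW ca) _; lra.
Qed.

(** * Several variables *)

Definition upd (T : Type) (n : nat) (z : 'rV[T]_n) (j : 'I_n) (x : T) : 'rV[T]_n :=
  \row_i (if i == j then x else z ord0 i).

Arguments upd {T n}.

Lemma updE (T : Type) n (z : 'rV[T]_n) j x i :
  upd z j x ord0 i = if i == j then x else z ord0 i.
Proof. by rewrite mxE. Qed.

Lemma upd_same (T : Type) n (z : 'rV[T]_n) j : upd z j (z ord0 j) = z.
Proof. by apply/rowP => i; rewrite updE; case: eqP => [->|]. Qed.

Lemma upd_upd (T : Type) n (z : 'rV[T]_n) j x y :
  upd (upd z j x) j y = upd z j y.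
Proof. by apply/rowP => i; rewrite !updE; case: eqP. Qed.

Lemma updC (T : Type) n (z : 'rV[T]_n) j k x y : j != k ->
  upd (upd z j x) k y = upd (upd z k y) j x.
Proof.
move=> jk; apply/rowP => i; rewrite !updE.
have [->|//] := eqVneq i k.
by rewrite eq_sym (negbTE jk).
Qed.

Lemma polydomain_upd (T : Type) n (U : 'I_n -> set T) (z : 'rV[T]_n) j x :
  polydomain U z -> U j x -> polydomain U (upd z j x).
Proof. by move=> Uz Ux i /=; rewrite updE; case: eqP => [->|]. Qed.

Lemma polydomain_ind (T : Type) n (U : 'I_n -> set T) (P : 'rV[T]_n -> Prop) :
  (forall z j x, polydomain U z -> U j x -> P z -> P (upd z j x)) ->
  forall z w, polydomain U z -> polydomain U w -> P z -> P w.
Proof.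
move=> step z w Uz Uw Pz.
have agree k : (k <= n)%N -> exists y, [/\ polydomain U y, P y &
    forall i : 'I_n, (i < k)%N -> y ord0 i = w ord0 i].
  elim: k => [|k IH] kn; first by exists z.
  have [y [Uy Py yw]] := IH (ltnW kn).
  exists (upd y (Ordinal kn) (w ord0 (Ordinal kn))); split.
  - exact: polydomain_upd.
  - exact: step.
  - move=> i; rewrite ltnS leq_eqVlt updE.
    have [->//|ik] := eqVneq i (Ordinal kn).
    by case/orP => [/eqP ik'|/yw //]; case/eqP: ik; apply: val_inj.
have [y [Uy Py yw]] := agree n (leqnn n).
by have -> : w = y by apply/rowP => i; rewrite yw.
Qed.

Lemma hol_ext_open (R : realType) (Om : set (Cplx R)) (f g : Cplx R -> Cplx R)
    (z : Cplx R) :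
  open Om -> Om z -> (forall w, Om w -> f w = g w) -> hol f z -> hol g z.
Proof.
move=> oO Oz fg /holP[L hL]; apply/holP; exists L => e e0.
have [d d0 hd] := hL e e0; have [r r0 hr] := open_discP _ _ _ oO Oz.
exists (Num.min d r) => [|w]; first by rewrite lt_min d0 r0.
by rewrite lt_min => /andP[/hd h /hr Ow]; rewrite -!fg.
Qed.

(** The arguments below move one coordinate at a time, so holomorphy is recorded separately in each
    coordinate. *)
Definition sephol (R : realType) (n : nat) (U : 'I_n -> set (Cplx R))
    (F : 'rV[Cplx R]_n -> Cplx R) : Prop :=
  forall z j x, polydomain U z -> U j x -> hol (fun y => F (upd z j y)) x.

Arguments sephol {R n}.

Lemma sephol_ext (R : realType) (n : nat) (U : 'I_n -> set (Cplx R))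
    (F H : 'rV[Cplx R]_n -> Cplx R) :
  (forall j, open (U j)) ->
  (forall z, polydomain U z -> F z = H z) -> sephol U F -> sephol U H.
Proof.
move=> oU FH sF z j x Uz Ux.
apply: (hol_ext_open R (U j) _ _ x (oU j) Ux _ (sF z j x Uz Ux)) => w Uw.
by apply: FH; exact: polydomain_upd.
Qed.

Lemma sephol_upd (R : realType) (n : nat) (U : 'I_n -> set (Cplx R))
    (F : 'rV[Cplx R]_n -> Cplx R) j x :
  U j x -> sephol U F -> sephol U (fun z => F (upd z j x)).
Proof.
move=> Ux sF z k y Uz Uy; have [->|kj] := eqVneq k j.
  apply: (hol_ext _ (fun=> F (upd z j x))); last exact: holC.
  by move=> t; rewrite upd_upd.
apply: (hol_ext _ (fun t => F (upd (upd z j x) k t))).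
  by move=> t; rewrite updC // eq_sym.
by apply: sF => //; exact: polydomain_upd.
Qed.

(** The points p and q are made to agree one coordinate after another, each time by the one-variable
    statement, while F stays nonzero at the first and H at the second. *)
Lemma common_nonzero_multi (R : realType) (n : nat) (U : 'I_n -> set (Cplx R))
    (F H : 'rV[Cplx R]_n -> Cplx R) p q :
  (forall j, open (U j)) -> (forall j, connected (U j)) ->
  sephol U F -> sephol U H ->
  polydomain U p -> F p != 0 -> polydomain U q -> H q != 0 ->
  exists z, [/\ polydomain U z, F z != 0 & H z != 0].
Proof.
move=> oU cU sF sH Up Fp Uq Hq.
have agree k : (k <= n)%N -> exists p' q',
    [/\ polydomain U p' /\ F p' != 0, polydomain U q' /\ H q' != 0 &
    forall i : 'I_n, (i < k)%N -> p' ord0 i = q' ord0 i].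
  elim: k => [|k IH] kn; first by exists p, q.
  have [p' [q' [[Up' Fp'] [Uq' Hq'] pq]]] := IH (ltnW kn).
  pose j := Ordinal kn.
  have [x [Ux Fx Hx]] : exists x, [/\ U j x, F (upd p' j x) != 0 &
      H (upd q' j x) != 0].
    apply: (common_nonzero R (U j) _ _ (p' ord0 j) (q' ord0 j) (oU j) (cU j)).
    - by move=> z Uz; exact: sF.
    - by move=> z Uz; exact: sH.
    - exact: Up'.
    - by rewrite upd_same.
    - exact: Uq'.
    - by rewrite upd_same.
  exists (upd p' j x), (upd q' j x); split.
  - by split=> //; exact: polydomain_upd.
  - by split=> //; exact: polydomain_upd.
  - move=> i; rewrite ltnS leq_eqVlt !updE.
    have [//|ij] := eqVneq i j.
    by case/orP => [/eqP ik|/pq //]; case/eqP: ij; apply: val_inj.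
have [p' [q' [[Up' Fp'] [Uq' Hq'] pq]]] := agree n (leqnn n).
have E : p' = q' by apply/rowP => i; exact: pq.
by exists p'; split=> //; rewrite E.
Qed.

Lemma sephol_prod_eq0 (R : realType) (n : nat) (U : 'I_n -> set (Cplx R))
    (I : eqType) (s : seq I) (F : I -> 'rV[Cplx R]_n -> Cplx R) p :
  (forall j, open (U j)) -> (forall j, connected (U j)) ->
  polydomain U p ->
  (forall i, i \in s -> sephol U (F i)) ->
  (forall i, i \in s -> exists2 z, polydomain U z & F i z != 0) ->
  exists2 z, polydomain U z & forall i, i \in s -> F i z != 0.
Proof.
move=> oU cU Up sF Fn.
suff [z Uz] : exists2 z, polydomain U z & \prod_(i <- s) F i z != 0.
  rewrite prodf_seq_neq0 => /allP h; exists z => // i /h; exact.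
elim: s sF Fn => [|i s IH] sF Fn.
  by exists p => //; rewrite big_nil oner_neq0.
have [||z1 Uz1 Fz1] := IH.
- by move=> k ks; apply: sF; rewrite inE ks orbT.
- by move=> k ks; apply: Fn; rewrite inE ks orbT.
have [z2 Uz2 Fz2] := Fn i (mem_head _ _).
have [||z [Uz h1 h2]] := common_nonzero_multi R n U (F i)
  (fun z => \prod_(k <- s) F k z) z2 z1 oU cU _ _ Uz2 Fz2 Uz1 Fz1.
- by apply: sF; exact: mem_head.
- move=> z j x Uz Ux.
  (* Holomorphy is known for members of [s] only; the guard with default 1 gives every factor a
     meaning for [hol_prod]. *)
  apply: (hol_ext _ (fun y => \prod_(k <- s) (if k \in s then F k (upd z j y) else 1))).
    by move=> y; rewrite big_seq [RHS]big_seq; apply: eq_bigr => k ->.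
  apply: hol_prod => k _; have [ks|ks] := boolP (k \in s); last exact: holC.
  by apply: sF => //; rewrite inE ks orbT.
by exists z => //; rewrite big_cons mulf_neq0.
Qed.

Lemma common_nonzero_seq (R : realType) (U : set (Cplx R)) (I : eqType)
    (s : seq I) (F : I -> Cplx R -> Cplx R) p :
  open U -> connected U -> U p ->
  (forall i z, i \in s -> U z -> hol (F i) z) ->
  (forall i, i \in s -> exists2 z, U z & F i z != 0) ->
  exists2 z, U z & forall i, i \in s -> F i z != 0.
Proof.
move=> oU cU Up hF Fn.
elim: s hF Fn => [|i s IH] hF Fn; first by exists p.
have [||z1 Uz1 Fz1] := IH.
- by move=> k z ks Uz; apply: hF => //; rewrite inE ks orbT.
- by move=> k ks; apply: Fn; rewrite inE ks orbT.
have [z2 Uz2 Fz2] := Fn i (mem_head _ _).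
have [|||z [Uz h1 h2]] := common_nonzero R U (F i)
  (fun z => \prod_(k <- s) F k z) z2 z1 oU cU _ _ Uz2 Fz2 Uz1 _.
- by move=> z Uz; apply: hF => //; exact: mem_head.
- move=> z Uz.
  apply: (hol_ext _ (fun y => \prod_(k <- s) (if k \in s then F k y else 1))).
    by move=> y; rewrite big_seq [RHS]big_seq; apply: eq_bigr => k ->.
  apply: hol_prod => k _; have [ks|ks] := boolP (k \in s); last exact: holC.
  by apply: hF => //; rewrite inE ks orbT.
- rewrite prodf_seq_neq0; apply/allP => k ks; exact: Fz1.
exists z => // k; rewrite inE => /orP[/eqP -> //|ks].
by move: h2; rewrite prodf_seq_neq0 => /allP/(_ k ks).
Qed.

(** * Resultants and common roots *)

(** The Sylvester matrix with its dimensions given independently of the polynomials, so that its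
    determinant can be differentiated and taken to the limit in the coefficients. *)
Definition syl (K : nzRingType) (a b : nat) (p q : {poly K}) : 'M[K]_(a + b) :=
  \matrix_(i, j) match fintype.split i with
    | inl k => p`_(j - k) *+ (k <= j)%N
    | inr k => q`_(j - k) *+ (k <= j)%N
  end.

Arguments syl {K}.

Lemma det_syl (K : idomainType) (m : nat) (p q : {poly K}) :
  size p = m.+1 -> size q = m.+1 -> \det (syl m m p q) = resultant p q.
Proof.
move=> sp sq.
suff H a b : (size q).-1 = a -> (size p).-1 = b ->
    \det (syl a b p q) = resultant p q by apply: H; rewrite ?sp ?sq.
move=> <- <-; rewrite /resultant; congr (\det _).
by apply/matrixP => i j; rewrite Sylvester_mxE mxE.
Qed.

Lemma det_syl_eq0 (K : closedFieldType) (m : nat) (p q : {poly K}) :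
  size p = m.+1 -> size q = m.+1 ->
  \det (syl m m p q) = 0 <-> exists v, root p v /\ root q v.
Proof.
move=> sp sq; rewrite det_syl //.
have p0 : p != 0 by rewrite -size_poly_eq0 sp.
have g0 : gcdp p q != 0 by rewrite gcdp_eq0 negb_and p0.
split.
  move/eqP; rewrite resultant_eq0 => h.
  have /closed_rootP[v] : size (gcdp p q) != 1%N by rewrite neq_ltn h orbT.
  by rewrite root_gcd => /andP[pv qv]; exists v.
move=> [v [pv qv]]; apply/eqP; rewrite resultant_eq0.
by apply: (root_size_gt1 (a := v)) => //; rewrite root_gcd pv.
Qed.

Lemma hol_det_syl (R : realType) (m : nat) (p q : Cplx R -> {poly Cplx R})
    (z : Cplx R) :
  (forall k, hol (fun x => (p x)`_k) z) -> (forall k, hol (fun x => (q x)`_k) z) ->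
  hol (fun x => \det (syl m m (p x) (q x))) z.
Proof.
move=> hp hq.
have entry i j : hol (fun x => syl m m (p x) (q x) i j) z.
  apply: (hol_ext _ (fun x => match fintype.split i with
      | inl k => (p x)`_(j - k) *+ (k <= j)%N
      | inr k => (q x)`_(j - k) *+ (k <= j)%N end)).
    by move=> x; rewrite mxE.
  case: (fintype.split i) => k; case: (k <= j)%N.
  - exact: (hp (j - k)%N).
  - exact: (holC _ 0).
  - exact: (hq (j - k)%N).
  - exact: (holC _ 0).
rewrite /determinant; apply: hol_sum => s _.
apply: holM; first exact: holC.
by apply: hol_prod => i _; exact: entry.
Qed.

Lemma cvgC_sum (R : realType) (T : Type) (F : set_system T) (FF : Filter F)
    (I : Type) (s : seq I) (P : pred I) (u : I -> T -> Cplx R)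
    (l : I -> Cplx R) :
  (forall i, u i @ F --> l i) ->
  (fun x => \sum_(i <- s | P i) u i x) @ F --> \sum_(i <- s | P i) l i.
Proof.
move=> h; elim: s => [|i s IH].
  rewrite big_nil (_ : (fun x => _) = fun=> 0); last first.
    by apply/funext => x; rewrite big_nil.
  exact: cvg_cst.
rewrite big_cons; have [Pi|Pi] := boolP (P i).
  rewrite (_ : (fun x => _) = fun x => u i x + \sum_(j <- s | P j) u j x).
    exact: cvgD (h i) IH.
  by apply/funext => x; rewrite big_cons Pi.
rewrite (_ : (fun x => _) = fun x => \sum_(j <- s | P j) u j x); first exact: IH.
by apply/funext => x; rewrite big_cons (negbTE Pi).
Qed.

Lemma cvgC_prod (R : realType) (T : Type) (F : set_system T) (FF : Filter F)
    (I : Type) (s : seq I) (P : pred I) (u : I -> T -> Cplx R)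
    (l : I -> Cplx R) :
  (forall i, u i @ F --> l i) ->
  (fun x => \prod_(i <- s | P i) u i x) @ F --> \prod_(i <- s | P i) l i.
Proof.
move=> h; elim: s => [|i s IH].
  rewrite big_nil (_ : (fun x => _) = fun=> 1); last first.
    by apply/funext => x; rewrite big_nil.
  exact: cvg_cst.
rewrite big_cons; have [Pi|Pi] := boolP (P i).
  rewrite (_ : (fun x => _) = fun x => u i x * \prod_(j <- s | P j) u j x).
    exact: cvgM (h i) IH.
  by apply/funext => x; rewrite big_cons Pi.
rewrite (_ : (fun x => _) = fun x => \prod_(j <- s | P j) u j x); first exact: IH.
by apply/funext => x; rewrite big_cons (negbTE Pi).
Qed.

Lemma cvg_det_syl (R : realType) (T : Type) (F : set_system T) (FF : Filter F)
    (m : nat) (p q : T -> {poly Cplx R}) (p' q' : {poly Cplx R}) :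
  (forall k, (fun x => (p x)`_k) @ F --> p'`_k) ->
  (forall k, (fun x => (q x)`_k) @ F --> q'`_k) ->
  (fun x => \det (syl m m (p x) (q x))) @ F --> \det (syl m m p' q').
Proof.
move=> hp hq.
have entry i j : (fun x => syl m m (p x) (q x) i j) @ F --> syl m m p' q' i j.
  rewrite mxE (_ : (fun x => _) = fun x => match fintype.split i with
      | inl k => (p x)`_(j - k) *+ (k <= j)%N
      | inr k => (q x)`_(j - k) *+ (k <= j)%N end); last first.
    by apply/funext => x; rewrite mxE.
  case: (fintype.split i) => k; case: (k <= j)%N.
  - exact: (hp (j - k)%N).
  - exact: cvg_cst.
  - exact: (hq (j - k)%N).
  - exact: cvg_cst.
rewrite /determinant; apply: cvgC_sum => s.
apply: cvgM; first exact: cvg_cst.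
by apply: cvgC_prod => i; exact: entry.
Qed.

Lemma coef_prod_XsubC_le (R : realType) (B : R) (s : seq (Cplx R)) k :
  0 <= B -> (forall w, w \in s -> cabs w <= B) ->
  cabs (\prod_(w <- s) ('X - w%:P))`_k <= (1 + B) ^+ size s.
Proof.
move=> B0; elim: s k => [|w s IH] k hs.
  rewrite big_nil coef1 expr0; case: (k == 0%N); rewrite ?cabs1 //=.
  by rewrite cabs0 ler01.
have hs' v : v \in s -> cabs v <= B by move=> vs; apply: hs; rewrite inE vs orbT.
have {}IH i := IH i hs'.
rewrite big_cons mulrBl coefB coefXM coefCM exprS.
apply: le_trans (cabsB _ _ _) _; rewrite mulrDl mul1r; apply: lerD.
  case: (k == 0%N); last exact: IH.
  by rewrite cabs0 exprn_ge0 // addr_ge0.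
rewrite cabsM; apply: ler_pM; rewrite ?cabs_ge0 //.
by apply: hs; exact: mem_head.
Qed.

Lemma hol_coef_prod (R : realType) (I : Type) (s : seq I)
    (h : I -> Cplx R -> Cplx R) (z : Cplx R) k :
  (forall i, hol (h i) z) ->
  hol (fun x => (\prod_(i <- s) ('X - (h i x)%:P))`_k) z.
Proof.
move=> hh; elim: s k => [|i s IH] k.
  by apply: (hol_ext _ (fun=> (1 : {poly Cplx R})`_k)) => [x|];
    [rewrite big_nil|exact: holC].
apply: (hol_ext _ (fun x =>
  (if k == 0%N then 0 else (\prod_(i <- s) ('X - (h i x)%:P))`_k.-1) -
  h i x * (\prod_(i <- s) ('X - (h i x)%:P))`_k)).
  by move=> x; rewrite big_cons mulrBl coefB coefXM coefCM.
apply: holB; last by apply: holM; [exact: hh|exact: IH].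
by case: (k == 0%N); [exact: holC|exact: IH].
Qed.

(** Bounded coefficients converge along an ultrafilter, and the constant leading coefficient c
    prevents the degree from dropping in the limit. *)
Lemma limit_poly (R : realType) (T : Type) (F : set_system T)
    (FU : UltraFilter F) (m : nat) (c : Cplx R) (B : R)
    (Q : T -> {poly Cplx R}) (v : Cplx R) :
  c != 0 ->
  F [set x | [/\ size (Q x) = m.+1, (Q x)`_m = c &
                 forall k, cabs (Q x)`_k <= B]] ->
  tends0 F (fun x => (Q x).[v]) ->
  exists p : {poly Cplx R}, [/\ size p = m.+1, root p v &
    forall k, (fun x => (Q x)`_k) @ F --> p`_k].
Proof.
move=> c0 FQ Qv.
have PF : ProperFilter F by exact: ultra_proper.
have FF : Filter F by exact: filter_filter.
have lim_k k : exists l : Cplx R, (fun x => (Q x)`_k) @ F --> l.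
  have := ultra_compact_cvg _ _ F (fun x => (Q x)`_k) _ FU (compact_disc R 0 B).
  case=> [|l _ hl]; last by exists l.
  by apply: filterS FQ => x /= [_ _ /(_ k)]; rewrite subr0.
have [l hl] := choice lim_k.
have uniq (u : T -> Cplx R) (a b : Cplx R) : u @ F --> a -> u @ F --> b -> a = b.
  move=> ha hb.
  exact: (@cvg_unique _ (@norm_hausdorff _ (Cplx R)) _ _ _ _ ha hb).
have lm : l m = c.
  apply: (uniq _ _ _ (hl m)); apply/cvgCP => e e0.
  by apply: filterS FQ => x /= [_ -> _]; rewrite subrr cabs0.
pose p := \poly_(k < m.+1) l k.
have cp k : (fun x => (Q x)`_k) @ F --> p`_k.
  rewrite coef_poly; case: ltnP => km; first exact: hl.
  apply/cvgCP => e e0; apply: filterS FQ => x /= [sx _ _].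
  by rewrite nth_default ?sx // subrr cabs0.
have sp : size p = m.+1 by rewrite size_poly_eq // lm.
exists p; split=> //; apply/eqP.
apply: (uniq (fun x => (Q x).[v])); last first.
  by apply/cvgCP => e e0; apply: filterS (Qv e e0) => x /=; rewrite subr0.
rewrite (@horner_coef_wide _ m.+1 p) ?sp //.
have H : (fun x => \sum_(k < m.+1) (Q x)`_k * v ^+ k) @ F -->
    \sum_(k < m.+1) p`_k * v ^+ k.
  by apply: cvgC_sum => k; apply: cvgM; [exact: cp|exact: cvg_cst].
have /cvgCP H' := H.
apply/cvgCP => e e0; apply: filterS2 FQ (H' e e0) => x /= [sx _ _].
by rewrite (@horner_coef_wide _ m.+1) // sx.
Qed.

(* The resultant of two polynomials sharing the j-th coordinate is
   holomorphic in it and tends to 0 at the boundary, so it vanishes. *)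
Lemma family_common_root (R : realType) (n : nat) (U : 'I_n -> set (Cplx R))
    (Q : 'rV[Cplx R]_n -> {poly Cplx R}) (m : nat) (c : Cplx R) (B : R)
    (z0 : 'rV[Cplx R]_n) :
  (forall j, open (U j)) -> (forall j, connected (U j)) ->
  (forall j, bounded_set (U j)) -> polydomain U z0 -> c != 0 ->
  (forall z, polydomain U z -> [/\ size (Q z) = m.+1, (Q z)`_m = c &
     forall k, cabs (Q z)`_k <= B]) ->
  (forall k, sephol U (fun z => (Q z)`_k)) ->
  (forall j F q, UltraFilter F -> F (U j) -> tends0 F (fun x => x - q) ->
     ~ U j q -> exists v, forall z, polydomain U z ->
     tends0 F (fun x => (Q (upd z j x)).[v])) ->
  forall j x, U j x -> exists a, forall z, polydomain U z ->
    root (Q (upd z j x)) a.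
Proof.
move=> oU cU bU Uz0 c0 hQ sQ bdry j x Ux.
pose Rf z w y := \det (syl m m (Q (upd z j y)) (Q (upd w j y))).
have hRf z w : polydomain U z -> polydomain U w -> forall y, U j y -> hol (Rf z w) y.
  by move=> Uz Uw y Uy; apply: hol_det_syl => k; exact: sQ.
have Rf0 z w : polydomain U z -> polydomain U w -> Rf z w x = 0.
  move=> Uz Uw; apply: cvg_zero_const => e e0.
  have e2 : 0 < e / 2 by rewrite divr_gt0.
  have [D D0 hD] := bounded_setC _ _ (bU j).
  (* An ultrafilter on [K] cannot tend to a point outside U j: both polynomials would have limits
     vanishing at the same v, and the determinant would tend to 0. Hence [K] is compact. *)
  pose K := [set y | U j y /\ e / 2 <= cabs (Rf z w y)].
  have cK : compact K.
    rewrite compact_ultra => F FU FK.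
    have PF : ProperFilter F by exact: ultra_proper.
    have FF : Filter F by exact: filter_filter.
    have FUj : F (U j) by apply: filterS FK => y [].
    have [|q _ Fq] := ultra_compact_cvg _ _ F id _ FU (compact_disc R 0 D).
      by apply: filterS FUj => y /=; rewrite subr0; exact: hD.
    have Fq0 : tends0 F (fun y => y - q) by exact/cvgCP.
    exists q; split; last exact: Fq.
    have [Uq|nUq] := pselect (U j q).
      split=> //; rewrite leNgt; apply/negP => Rq.
      have d0 : 0 < e / 2 - cabs (Rf z w q) by rewrite subr_gt0.
      have [d d1 hd] := (continuousCP _ _ _).1
        (hol_continuous _ _ _ (hRf z w Uz Uw q Uq)) _ d0.
      have [y [[_ Ky] yq]] := filter_ex (filterI FK (Fq0 d d1)).
      have := hd y yq; have := cabs_trans _ (Rf z w y) (Rf z w q) 0.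
      rewrite !subr0; move: Ky; lra.
    exfalso.
    have [v hv] := bdry j F q FU FUj Fq0 nUq.
    have lim_w w' : polydomain U w' -> exists p : {poly Cplx R},
        [/\ size p = m.+1, root p v &
        forall k, (fun y => (Q (upd w' j y))`_k) @ F --> p`_k].
      move=> Uw'; apply: (limit_poly _ _ F FU m c B _ v c0); last exact: hv.
      by apply: filterS FUj => y Uy; apply: hQ; exact: polydomain_upd.
    have [p [sp pv hp]] := lim_w z Uz; have [q' [sq qv hq]] := lim_w w Uw.
    have := cvg_det_syl _ _ F FF m _ _ p q' hp hq.
    have -> : \det (syl m m p q') = 0.
      by apply/(det_syl_eq0 (Cplx R) m p q' sp sq); exists v.
    move=> /cvgCP/(_ _ e2) H.
    have [y [[_ Ky] /=]] := filter_ex (filterI FK H).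
    by rewrite subr0 ltNge; move/negP; apply.
  have := maximum_principle R (U j) K (Rf z w) D (e / 2) (oU j) hD cK.
  move=> /(_ _ (hRf z w Uz Uw) (ltW e2) _ x Ux) H.
  apply: le_lt_trans (H _ _) _; last by lra.
    by move=> y [].
  move=> y Uy nK; rewrite leNgt; apply/negP => h; apply: nK.
  by split=> //; exact: ltW.
have share z w : polydomain U z -> polydomain U w ->
    exists a, root (Q (upd z j x)) a /\ root (Q (upd w j x)) a.
  move=> Uz Uw; have [sz _ _] := hQ _ (polydomain_upd _ _ _ _ _ _ Uz Ux).
  have [sw _ _] := hQ _ (polydomain_upd _ _ _ _ _ _ Uw Ux).
  by apply/(det_syl_eq0 (Cplx R) m _ _ sz sw); exact: Rf0.
have Uz1 := polydomain_upd _ _ _ _ _ _ Uz0 Ux.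
have [r Er] := closed_field_poly_normal (Q (upd z0 j x)).
have lc0 : lead_coef (Q (upd z0 j x)) != 0.
  by rewrite lead_coef_eq0 -size_poly_eq0; have [-> _ _] := hQ _ Uz1.
have inr z : polydomain U z -> exists2 a, a \in r & root (Q (upd z j x)) a.
  move=> Uz; have [a [h1 h2]] := share z z0 Uz Uz0; exists a => //.
  by move: h2; rewrite Er rootZ // root_prod_XsubC.
(* The candidates are the finitely many roots [r] of one polynomial. If each of them failed
   somewhere, all would fail at a single z, against the pairwise statement. *)
apply: contrapT => H.
have [||z Uz hz] := sephol_prod_eq0 R n U _ r (fun a z => (Q (upd z j x)).[a]) z0
   oU cU Uz0.
- move=> a _; apply: (sephol_upd _ _ _ (fun z => (Q z).[a]) j x Ux).
  apply: (sephol_ext _ _ _ (fun z => \sum_(k < m.+1) (Q z)`_k * a ^+ k)) => //.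
    by move=> z Uz; rewrite (@horner_coef_wide _ m.+1) //; have [-> _ _] := hQ _ Uz.
  move=> z k y Uz Uy; apply: hol_sum => i _.
  by apply: holM; [exact: sQ|exact: holC].
- move=> a _; apply: contrapT => Ha; apply: H; exists a => z Uz.
  by apply/negPn/negP => ha; apply: Ha; exists z.
have [a ar /eqP ha] := inr z Uz.
by move/eqP: (hz a ar); apply.
Qed.

(** * Boundary decay and separation of the common roots *)

Lemma sephol_horner (R : realType) (n : nat) (U : 'I_n -> set (Cplx R))
    (P : 'rV[Cplx R]_n -> {poly Cplx R}) (m : nat) (v : Cplx R) :
  (forall j, open (U j)) ->
  (forall z, polydomain U z -> (size (P z) <= m)%N) ->
  (forall k, sephol U (fun z => (P z)`_k)) ->
  sephol U (fun z => (P z).[v]).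
Proof.
move=> oU szP sP.
apply: (sephol_ext _ _ _ (fun z => \sum_(k < m) (P z)`_k * v ^+ k)) => //.
  by move=> z Uz; rewrite (@horner_coef_wide _ m) //; exact: szP.
move=> z k y Uz Uy; apply: hol_sum => i _.
by apply: holM; [exact: sP|exact: holC].
Qed.

Lemma prod_XsubC_bound (R : realType) (n : nat) (w : 'I_n -> Cplx R) (v : Cplx R)
    (B : R) : 0 <= B -> (forall i, cabs (w i) <= B) ->
  cabs (\prod_(i < n) ('X - (w i)%:P)).[v] <= (cabs v + B) ^+ n.
Proof.
move=> B0 wB; rewrite horner_prod cabs_prod.
have -> : (cabs v + B) ^+ n = \prod_(i < n) (cabs v + B).
  by rewrite prodr_const card_ord.
apply: ler_prod => i _; rewrite cabs_ge0 hornerXsubC /=.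
by apply: le_trans (cabsB _ _ _) _; rewrite lerD2l.
Qed.

(** In [hurwitz] the index is the value of the j-th coordinate and the variable is another
    coordinate k. Boundedness of V provides the uniform bound. *)
Lemma boundary_spread (R : realType) (n : nat) (U : 'I_n -> set (Cplx R))
    (V : set (Cplx R)) (P : 'rV[Cplx R]_n -> {poly Cplx R})
    (w : 'rV[Cplx R]_n -> 'I_n -> Cplx R) (B : R) :
  (forall j, open (U j)) -> (forall j, connected (U j)) ->
  0 <= B -> (forall v, V v -> cabs v <= B) ->
  (forall z, polydomain U z -> P z = \prod_(i < n) ('X - (w z i)%:P)) ->
  (forall z i, polydomain U z -> V (w z i)) ->
  (forall k, sephol U (fun z => (P z)`_k)) ->
  forall j (F : set_system (Cplx R)) v, UltraFilter F -> F (U j) -> ~ V v ->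
  forall z z', polydomain U z -> polydomain U z' ->
  tends0 F (fun x => (P (upd z j x)).[v]) ->
  tends0 F (fun x => (P (upd z' j x)).[v]).
Proof.
move=> oU cU B0 VB hP wV sP j F v FU FUj nVv.
have PF : ProperFilter F by exact: ultra_proper.
have FF : Filter F by exact: filter_filter.
have szP z : polydomain U z -> (size (P z) <= n.+1)%N.
  by move=> Uz; rewrite hP // size_prod_XsubC /index_enum -enumT size_enum_ord.
apply: (polydomain_ind _ _ U
  (fun z => tends0 F (fun x => (P (upd z j x)).[v]))) => z k x Uz Ux Tz.
have [->|kj] := eqVneq k j.
  have -> : (fun y => (P (upd (upd z j x) j y)).[v]) =
      fun y => (P (upd z j y)).[v] by apply/funext => y; rewrite upd_upd.
  exact: Tz.
pose h y t := (P (upd (upd z k t) j y)).[v].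
have Tz' : tends0 F (fun y => h y (z ord0 k)) by rewrite /h upd_same.
apply: (hurwitz R _ F FU (U k) ((cabs v + B) ^+ n) h (oU k) (cU k) _ _
  (z ord0 k) x (Uz k) Ux Tz').
  by rewrite exprn_ge0 // addr_ge0 // cabs_ge0.
apply: filterS FUj => y Uy t Ut.
have Uzt : polydomain U (upd (upd z k t) j y) by do 2 ?apply: polydomain_upd.
split.
- apply: (hol_ext _ (fun s => (P (upd (upd z j y) k s)).[v])).
    by move=> s; rewrite /h updC // eq_sym.
  by apply: (sephol_horner R n U P n.+1 v oU szP sP) => //; exact: polydomain_upd.
- rewrite /h hP // horner_prod; apply/prodf_neq0 => i _.
  rewrite hornerXsubC subr_eq0; apply/eqP => E; apply: nVv; rewrite E; exact: wV.
- rewrite /h hP //; apply: prod_XsubC_bound => // i.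
  by apply: VB; exact: wV.
Qed.

(** A common divisor of largest degree: a root a shared by all quotients would allow it to be
    multiplied by X - a. *)
Lemma max_common_divisor (K : fieldType) (T : Type) (G : set T)
    (P : T -> {poly K}) (m : nat) z0 :
  G z0 -> (forall z, G z -> size (P z) = m.+1) ->
  exists E : {poly K}, [/\ E != 0, forall z, G z -> E %| P z &
    forall a, exists2 z, G z & ~~ root (P z %/ E) a].
Proof.
move=> Gz0 szP.
pose D k := `[< exists E : {poly K}, size E = k /\ forall z, G z -> E %| P z >].
have D1 : exists k, D k.
  exists 1%N; apply/asboolP; exists 1; rewrite size_poly1; split=> // z _.
  exact: dvd1p.
have Dm k : D k -> (k <= m.+1)%N.
  move=> /asboolP[E [<- hE]]; rewrite -(szP _ Gz0).
  by apply: dvdp_leq (hE _ Gz0); rewrite -size_poly_eq0 szP.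
case: (ex_maxnP D1 Dm) => k /asboolP[E [sE hE]] kmax.
have E0 : E != 0.
  apply: contraTneq (hE _ Gz0) => ->; rewrite dvd0p -size_poly_eq0 szP //.
exists E; split=> // a; apply: contrapT => H.
have /kmax : D k.+1.
  apply/asboolP; exists (('X - a%:P) * E); split.
    by rewrite size_mul ?polyXsubC_eq0 // size_XsubC sE.
  move=> z Gz; rewrite -(divpK (hE z Gz)) dvdp_mul2r // dvdp_XsubCl.
  by apply/negPn/negP => ra; apply: H; exists z.
by rewrite ltnn.
Qed.

(** Division by a fixed polynomial is linear, so the coefficients of the quotients inherit bounds
    and holomorphy from those of the dividends. *)
Lemma coef_divp_lin (K : fieldType) (m : nat) (p E : {poly K}) k :
  (size p <= m)%N ->
  (p %/ E)`_k = \sum_(i < m) p`_i * ('X^i %/ E)`_k.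
Proof.
move=> sp.
have -> : p %/ E = \sum_(i < m) p`_i *: ('X^i %/ E).
  rewrite -{1}(coefK p) poly_def.
  have H s : (\sum_(i <- s) p`_i *: 'X^i) %/ E =
      \sum_(i <- s) p`_i *: ('X^i %/ E) :> {poly K}.
    by elim: s => [|i s IH]; rewrite ?big_nil ?div0p // !big_cons divpD divpZl IH.
  rewrite -(big_mkord xpredT (fun i => p`_i *: 'X^i)).
  rewrite -(big_mkord xpredT (fun i => p`_i *: ('X^i %/ E))) H.
  have tail0 : \sum_(size p <= i < m) p`_i *: ('X^i %/ E) = 0.
    rewrite big_nat big1 // => i /andP[hi _].
    by rewrite nth_default ?scale0r.
  by rewrite [RHS](big_cat_nat _ sp) //= tail0 addr0.
by rewrite coef_sum; apply: eq_bigr => i _; rewrite coefZ.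
Qed.

(** The work is done on the quotients [Q z] by the largest common divisor [E]; the conclusions
    return to [P z] because [E] turns out to be constant. *)
Lemma separated_point (R : realType) (n : nat) (U : 'I_n -> set (Cplx R))
    (V : set (Cplx R)) (P : 'rV[Cplx R]_n -> {poly Cplx R})
    (w : 'rV[Cplx R]_n -> 'I_n -> Cplx R) (B : R) (zs : 'rV[Cplx R]_n) :
  (forall j, open (U j)) -> (forall j, connected (U j)) ->
  (forall j, bounded_set (U j)) -> polydomain U zs ->
  0 <= B -> (forall v, V v -> cabs v <= B) ->
  (forall z, polydomain U z -> P z = \prod_(i < n) ('X - (w z i)%:P)) ->
  (forall z i, polydomain U z -> V (w z i)) ->
  (forall k, sephol U (fun z => (P z)`_k)) ->
  (forall j F q z, UltraFilter F -> F (U j) -> tends0 F (fun x => x - q) ->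
     ~ U j q -> polydomain U z -> exists v, ~ V v /\
     tends0 F (fun x => (P (upd z j x)).[v])) ->
  exists z0 (a : 'I_n -> Cplx R), [/\ polydomain U z0, injective a,
    forall j z, polydomain U z -> root (P (upd z j (z0 ord0 j))) (a j),
    forall j x, U j x -> exists b, forall z, polydomain U z ->
      root (P (upd z j x)) b &
    forall b, exists2 z, polydomain U z & ~~ root (P z) b].
Proof.
move=> oU cU bU Uzs B0 VB hP wV sP bdry.
have szP z : polydomain U z -> size (P z) = n.+1.
  by move=> Uz; rewrite hP // size_prod_XsubC /index_enum -enumT size_enum_ord.
have [E [E0 dE nE]] := max_common_divisor _ _ (polydomain U) P n zs Uzs szP.
pose Q z := P z %/ E.
have PQ z : polydomain U z -> P z = Q z * E by move=> Uz; rewrite divpK // dE.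
have sE : (0 < size E)%N by rewrite size_poly_gt0.
have sEn : (size E <= n.+1)%N.
  by rewrite -(szP _ Uzs); apply: dvdp_leq (dE _ Uzs); rewrite -size_poly_eq0 szP.
pose m := (n.+1 - size E)%N.
have sQ z : polydomain U z -> size (Q z) = m.+1.
  move=> Uz; rewrite /Q size_divp // szP // /m.
  by move: (size E) sE sEn => e; lia.
have rootP z v : polydomain U z -> root (P z) v -> V v.
  move=> Uz; rewrite hP // /root horner_prod => /prodf_eq0[i _].
  rewrite hornerXsubC subr_eq0 => /eqP ->; exact: wV.
pose c := (lead_coef E)^-1.
have c0 : c != 0 by rewrite invr_eq0 lead_coef_eq0.
have lQ z : polydomain U z -> (Q z)`_m = c.
  move=> Uz; have lP : lead_coef (P z) = 1.
    by rewrite hP //; apply/monicP; exact: monic_prod_XsubC.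
  have : lead_coef (Q z) * lead_coef E = 1 by rewrite -lead_coefM -PQ.
  rewrite [lead_coef (Q z)]lead_coefE sQ //= => h.
  apply: (mulIf (x := lead_coef E)); rewrite ?lead_coef_eq0 // h.
  by rewrite mulVf ?lead_coef_eq0.
have Pb z k : polydomain U z -> cabs (P z)`_k <= (1 + B) ^+ n.
  move=> Uz; rewrite hP // -(big_map (w z) xpredT (fun t => 'X - t%:P)).
  have := coef_prod_XsubC_le R B [seq w z i | i <- index_enum 'I_n] k B0.
  rewrite size_map /index_enum -enumT size_enum_ord; apply.
  by move=> v /mapP[i _ ->]; apply: VB; exact: wV.
have coefQ z k : polydomain U z ->
    (Q z)`_k = \sum_(i < n.+1) (P z)`_i * ('X^i %/ E)`_k.
  by move=> Uz; apply: coef_divp_lin; rewrite szP.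
pose Bk k := \sum_(i < n.+1) (1 + B) ^+ n * cabs ('X^i %/ E)`_k.
have Bk0 k : 0 <= Bk k.
  by apply: sumr_ge0 => i _; rewrite mulr_ge0 ?cabs_ge0 // exprn_ge0 // addr_ge0.
have Qb z k : polydomain U z -> cabs (Q z)`_k <= Bk k.
  move=> Uz; rewrite coefQ //.
  have H (s : seq 'I_n.+1) : cabs (\sum_(i <- s) (P z)`_i * ('X^i %/ E)`_k) <=
      \sum_(i <- s) (1 + B) ^+ n * cabs ('X^i %/ E)`_k.
    elim: s => [|i s IH]; first by rewrite !big_nil cabs0.
    rewrite !big_cons; apply: le_trans (cabsD _ _ _) _; apply: lerD => //.
    by rewrite cabsM ler_wpM2r ?cabs_ge0 // Pb.
  exact: H.
pose BQ := \sum_(k < m.+1) Bk k.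
have sQl k : sephol U (fun z => (Q z)`_k).
  apply: (sephol_ext _ _ _
    (fun z => \sum_(i < n.+1) (P z)`_i * ('X^i %/ E)`_k)) => //.
    by move=> z Uz; rewrite -coefQ.
  move=> z j x Uz Ux; apply: hol_sum => i _.
  by apply: holM; [exact: sP|exact: holC].
have common j x : U j x -> exists b, forall z, polydomain U z ->
    root (Q (upd z j x)) b.
  apply: (family_common_root R n U Q m c BQ zs oU cU bU Uzs c0 _ sQl).
    move=> z Uz; split; [exact: sQ|exact: lQ|] => k.
    have [km|km] := ltnP k m.+1.
      apply: le_trans (Qb z k Uz) _.
      rewrite /BQ (bigD1 (Ordinal km)) //= lerDl.
      by apply: sumr_ge0 => i _.
    rewrite nth_default ?sQ // cabs0; apply: sumr_ge0 => i _; exact: Bk0.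
  move=> j' F q FU FUj Fq nUq.
  have PF : ProperFilter F by exact: ultra_proper.
  have FF : Filter F by exact: filter_filter.
  have [v [nVv Fv]] := bdry j' F q zs FU FUj Fq nUq Uzs.
  exists v => z Uz.
  have Fz := boundary_spread R n U V P w B oU cU B0 VB hP wV sP j' F v FU FUj
    nVv zs z Uzs Uz Fv.
  (* Roots of [E] are roots of P, hence lie in V, and v does not; so the decay of P at v passes to
     Q. *)
  have Ev : E.[v] != 0.
    apply/negP => Ev; apply: nVv; apply: (rootP zs v Uzs).
    by rewrite PQ // rootM orbC; apply/orP; left.
  apply: (tends0_le _ _ F FF (fun x => (P (upd z j' x)).[v]) _ (cabs E.[v])^-1).
    apply: filterS FUj => y Uy /=.
    rewrite (PQ _ (polydomain_upd _ _ _ _ _ _ Uz Uy)) hornerM cabsM.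
    by rewrite mulrC mulfK // cabs_eq0.
  exact: Fz.
have [zeta [a [Uzeta roota dist]]] : exists (zeta a : 'I_n -> Cplx R),
    [/\ forall i, U i (zeta i),
        forall i z, polydomain U z -> root (Q (upd z i (zeta i))) (a i) &
        forall i i' : 'I_n, (i < i')%N -> a i != a i'].
  have H k : (k <= n)%N -> exists (zeta a : 'I_n -> Cplx R),
    [/\ forall i : 'I_n, (i < k)%N -> U i (zeta i),
        forall (i : 'I_n) z, (i < k)%N -> polydomain U z ->
          root (Q (upd z i (zeta i))) (a i) &
        forall i i' : 'I_n, (i < i')%N -> (i' < k)%N -> a i != a i'].
    elim: k => [|k IH] kn; first by exists (fun=> 0), (fun=> 0).
    have [zeta [a [h1 h2 h3]]] := IH (ltnW kn).
    pose j := Ordinal kn.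
    (* For each earlier root b, the point [zb b] shows that b is not a root of all Q. Where none of
       these finitely many functions of x vanishes, the common root belonging to x differs from
       every element of [L]. *)
    pose L := [seq a i | i : 'I_n <- enum 'I_n & (i < k)%N].
    have nE' b : exists z, polydomain U z /\ ~~ root (Q z) b.
      by have [z Uz hz] := nE b; exists z.
    have [zb hzb] := choice nE'.
    have [||x Ux hx] := common_nonzero_seq R (U j) _ L
        (fun b x => (Q (upd (zb b) j x)).[b]) (zs ord0 j) (oU j) (cU j) (Uzs j).
    - move=> b x _ Ux; have [Ub _] := hzb b.
      apply: (sephol_horner R n U Q m.+1 b oU _ sQl) => //.
      by move=> z Uz; rewrite sQ.
    - move=> b _; have [Ub rb] := hzb b; exists (zb b ord0 j); first exact: Ub.
      by rewrite upd_same.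
    have [b hb] := common j x Ux.
    exists (fun i => if i == j then x else zeta i),
      (fun i => if i == j then b else a i); split.
    - move=> i; have [->//|ij] := eqVneq i j.
      rewrite ltnS leq_eqVlt => /orP[/eqP ik|]; last exact: h1.
      by case/eqP: ij; apply: val_inj.
    - move=> i z; have [-> _|ij] := eqVneq i j; first exact: hb.
      rewrite ltnS leq_eqVlt => /orP[/eqP ik|]; last exact: h2.
      by case/eqP: ij; apply: val_inj.
    - move=> i i' ii'; have [i'j|i'j] := eqVneq i' j => i'k.
        have ik : (i < k)%N by rewrite i'j in ii'.
        have -> : (i == j) = false by apply/eqP => E'; rewrite E' ltnn in ik.
        have aL : a i \in L by apply: map_f; rewrite mem_filter ik mem_enum.
        have [Ub _] := hzb (a i).
        by apply: contra_neq (hx _ aL) => E'; have := hb _ Ub; rewrite -E' => /eqP.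
      have i'k' : (i' < k)%N.
        move: i'k; rewrite ltnS leq_eqVlt => /orP[/eqP ik|//].
        by case/eqP: i'j; apply: val_inj.
      have -> : (i == j) = false.
        by apply/eqP => E'; move: ii'; rewrite E' /= ltnNge ltnW.
      exact: h3.
  have [zeta [a [h1 h2 h3]]] := H n (leqnn n).
  by exists zeta, a; split=> *; [exact: h1|exact: h2|exact: h3].
pose z0 : 'rV[Cplx R]_n := \row_i zeta i.
have z0E i : z0 ord0 i = zeta i by rewrite mxE.
have Uz0 : polydomain U z0 by move=> i; rewrite z0E.
have inja : injective a.
  move=> i i' aii'; case: (ltngtP i i') => [/dist|/dist|/val_inj //];
    by rewrite aii' eqxx.
(* The quotient at [z0] has n distinct roots, while its degree is n minus the degree of [E]. *)
have sE1 : size E = 1%N.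
  have : (size [seq a i | i <- enum 'I_n] < size (Q z0))%N.
    apply: max_poly_roots.
    - by rewrite -size_poly_eq0 sQ.
    - apply/allP => _ /mapP[i _ ->].
      by have := roota i z0 Uz0; rewrite -z0E upd_same.
    - by rewrite map_inj_uniq // enum_uniq.
  rewrite size_map size_enum_ord sQ // /m; lia.
have rPQ z b : polydomain U z -> root (P z) b = root (Q z) b.
  move=> Uz; rewrite PQ // rootM.
  by move/eqP: sE1 => /size_poly1P[e e0 ->]; rewrite rootC (negbTE e0) orbF.
exists z0, a; split=> //.
- move=> j z Uz; rewrite rPQ ?z0E; first exact: roota.
  exact: polydomain_upd.
- move=> j x Ux; have [b hb] := common j x Ux; exists b => z Uz.
  by rewrite rPQ; [exact: hb|exact: polydomain_upd].
- by move=> b; have [z Uz hz] := nE b; exists z => //; rewrite rPQ.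
Qed.

(** * Factorization into functions of one coordinate *)

Lemma monic_size2 (K : fieldType) (q : {poly K}) :
  q \is monic -> size q = 2%N -> q = 'X - (- q`_0)%:P.
Proof.
move=> /monicP; rewrite lead_coefE => lq sq; rewrite sq /= in lq.
apply/polyP => k; rewrite polyCN opprK coefD coefX coefC.
case: k => [|[|k]] /=; rewrite ?add0r ?addr0 //.
by rewrite nth_default // sq.
Qed.

(** The missing root is read off the sum of all roots, so it depends on the coefficients by an
    explicit formula and is holomorphic when they are. *)
Lemma last_root (K : fieldType) (p : {poly K}) (s : seq K) :
  p \is monic -> size p = (size s).+2 -> uniq s -> all (root p) s ->
  p = ('X - (- p`_(size s) - \sum_(t <- s) t)%:P) * \prod_(t <- s) ('X - t%:P).
Proof.
move=> mp sp us rs.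
have /dvdpP[q Eq] : \prod_(t <- s) ('X - t%:P) %| p.
  by apply: uniq_roots_dvdp; rewrite // uniq_rootsE.
have mprod : \prod_(t <- s) ('X - t%:P) \is monic by exact: monic_prod_XsubC.
have mq : q \is monic by rewrite -(monicMr _ mprod) -Eq.
have sq : size q = 2%N.
  have := sp; rewrite Eq size_mul ?monic_neq0 ?monic_prod_XsubC // size_prod_XsubC.
  rewrite addnS /= => H; by apply/eqP; rewrite -(eqn_add2r (size s)) H.
have Ep : p = \prod_(t <- (- q`_0) :: s) ('X - t%:P).
  by rewrite big_cons -(monic_size2 _ _ mq sq).
have E : p`_(size s) = - (- q`_0 + \sum_(t <- s) t).
  have := @coefPn_prod_XsubC _ ((- q`_0) :: s) isT.
  by rewrite -Ep big_cons.
by rewrite E opprK addrK {1}Ep big_cons.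
Qed.

Lemma hol_horner (R : realType) (Om : set (Cplx R)) (p : Cplx R -> {poly Cplx R})
    (h : Cplx R -> Cplx R) (m : nat) (x : Cplx R) :
  open Om -> Om x -> (forall y, Om y -> (size (p y) <= m)%N) ->
  (forall k, hol (fun y => (p y)`_k) x) -> hol h x ->
  hol (fun y => (p y).[h y]) x.
Proof.
move=> oO Ox sp hp hh.
apply: (hol_ext_open R Om (fun y => \sum_(k < m) (p y)`_k * h y ^+ k) _ x oO Ox).
  by move=> y Oy; rewrite (@horner_coef_wide _ m) //; exact: sp.
by apply: hol_sum => k _; apply: holM; [exact: hp|exact: hol_pow].
Qed.

(** When only the j-th coordinate leaves [z0], the roots a i with i different from j persist,
    because the coordinates they belong to are unchanged. The one remaining root defines g j. *)
Lemma product_form (R : realType) (n : nat) (U : 'I_n -> set (Cplx R))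
    (V : set (Cplx R)) (P : 'rV[Cplx R]_n -> {poly Cplx R})
    (w : 'rV[Cplx R]_n -> 'I_n -> Cplx R) (z0 : 'rV[Cplx R]_n)
    (a : 'I_n -> Cplx R) :
  (forall j, open (U j)) -> (forall j, connected (U j)) ->
  (forall z, polydomain U z -> P z = \prod_(i < n) ('X - (w z i)%:P)) ->
  (forall z i, polydomain U z -> V (w z i)) ->
  (forall k, sephol U (fun z => (P z)`_k)) ->
  polydomain U z0 -> injective a ->
  (forall j z, polydomain U z -> root (P (upd z j (z0 ord0 j))) (a j)) ->
  (forall j x, U j x -> exists b, forall z, polydomain U z ->
      root (P (upd z j x)) b) ->
  (forall b, exists2 z, polydomain U z & ~~ root (P z) b) ->
  exists g : 'I_n -> Cplx R -> Cplx R,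
    (forall j x, U j x -> V (g j x) /\ hol (g j) x) /\
    (forall z, polydomain U z -> P z = \prod_(j < n) ('X - (g j (z ord0 j))%:P)).
Proof.
move=> oU cU hP wV sP Uz0 inja roota common nconst.
have szP z : polydomain U z -> size (P z) = n.+1.
  by move=> Uz; rewrite hP // size_prod_XsubC /index_enum -enumT size_enum_ord.
have mP z : polydomain U z -> P z \is monic.
  by move=> Uz; rewrite hP //; exact: monic_prod_XsubC.
have rootP z v : polydomain U z -> root (P z) v -> V v.
  move=> Uz; rewrite hP // /root horner_prod => /prodf_eq0[i _].
  rewrite hornerXsubC subr_eq0 => /eqP ->; exact: wV.
pose s j := [seq a i | i <- enum (predC1 j)].
have ss j : size (s j) = n.-1 by rewrite size_map -cardE cardC1 card_ord.
have us j : uniq (s j) by rewrite map_inj_uniq // enum_uniq.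
have n1 (j : 'I_n) : n = n.-1.+1 by case: n j {a U P w z0 oU cU hP wV sP Uz0
  inja roota common nconst szP mP rootP s ss us} => // -[].
pose g j x := - (P (upd z0 j x))`_n.-1 - \sum_(t <- s j) t.
have Pg j x : U j x -> P (upd z0 j x) =
    ('X - (g j x)%:P) * \prod_(t <- s j) ('X - t%:P).
  move=> Ux; have Uzx := polydomain_upd _ _ _ _ _ _ Uz0 Ux.
  rewrite /g -(ss j); apply: last_root; rewrite ?mP ?us //.
    by rewrite szP // ss -(n1 j).
  apply/allP => _ /mapP[i + ->]; rewrite mem_enum !inE => ij.
  have := roota i _ Uzx.
  have <- : upd z0 j x ord0 i = z0 ord0 i by rewrite updE (negbTE ij).
  by rewrite upd_same.
have gV j x : U j x -> V (g j x).
  move=> Ux; apply: (rootP (upd z0 j x)); first exact: polydomain_upd.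
  by rewrite Pg // rootM root_XsubC eqxx.
have gh j x : U j x -> hol (g j) x.
  move=> Ux; apply: holB; last exact: holC.
  by apply: holN; exact: sP.
(* If this failed at x, it would fail at some x2 where, moreover, no a i with i different from j is
   a common root. But the common root at x2 is a root of P on the line through [z0], so it is g j x2
   or one of these a i. *)
have rootg j z x : polydomain U z -> U j x -> root (P (upd z j x)) (g j x).
  move=> Uz Ux; apply/negPn/negP => nr.
  have nc' b : exists z, polydomain U z /\ ~~ root (P z) b.
    by have [z' Uz' hz'] := nconst b; exists z'.
  have [zb hzb] := choice nc'.
  have hF b y : U j y -> hol (fun t => (P (upd (zb b) j t)).[b]) y.
    move=> Uy; have [Ub _] := hzb b.
    apply: (sephol_horner R n U P n.+1 b oU _ sP) => //.
    by move=> z' Uz'; rewrite szP.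
  have [||x1 Ux1 hx1] := common_nonzero_seq R (U j) _ (s j)
      (fun b x => (P (upd (zb b) j x)).[b]) (z0 ord0 j) (oU j) (cU j) (Uz0 j).
  - by move=> b y _; exact: hF.
  - move=> b _; have [Ub rb] := hzb b; exists (zb b ord0 j); first exact: Ub.
    by rewrite upd_same.
  have [|||x2 [Ux2 h1 h2]] := common_nonzero R (U j)
      (fun y => (P (upd z j y)).[g j y])
      (fun y => \prod_(b <- s j) (P (upd (zb b) j y)).[b]) x x1
      (oU j) (cU j) _ _ Ux nr Ux1 _.
  - move=> y Uy; apply: (hol_horner R (U j) _ _ n.+1) => //.
    + by move=> t Ut; rewrite szP //; exact: polydomain_upd.
    + by move=> k; exact: sP.
    + exact: gh.
  - by move=> y Uy; apply: hol_prod => b _; exact: hF.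
  - by rewrite prodf_seq_neq0; apply/allP => b bs; exact: hx1.
  have [b hb] := common j x2 Ux2.
  have := hb z0 Uz0; rewrite Pg // rootM root_XsubC root_prod_XsubC.
  case/orP => [/eqP E|bs].
    by move/eqP: h1; apply; apply/eqP; rewrite -E; exact: hb.
  move: h2; rewrite prodf_seq_neq0 => /allP/(_ b bs)/eqP; apply.
  by apply/eqP; apply: hb; have [] := hzb b.
have ga j : g j (z0 ord0 j) = a j.
  have := roota j z0 Uz0; rewrite Pg; last exact: Uz0.
  rewrite rootM root_XsubC root_prod_XsubC => /orP[/eqP -> //|].
  by move=> /mapP[i + /inja E]; rewrite -E mem_enum !inE eqxx.
exists g; split; first by move=> j x Ux; split; [exact: gV|exact: gh].
have sg j : sephol U (fun z => g j (z ord0 j)).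
  move=> z i x Uz Ux; have [->|ij] := eqVneq j i.
    by apply: (hol_ext _ (g i)); [move=> t; rewrite updE eqxx|exact: gh].
  apply: (hol_ext _ (fun=> g j (z ord0 j))); last exact: holC.
  by move=> t; rewrite updE (negbTE ij).
move=> z Uz; apply/polyP => k; apply/eqP; rewrite -subr_eq0; apply/negPn/negP => Dz.
(* A discriminant over ordered pairs: where it is nonzero the g i are n distinct roots of P and
   determine it. It is nonzero at [z0], so a failure of the identity could be moved to a point where
   it is nonzero. *)
pose Delta (y : 'rV[Cplx R]_n) := \prod_(i < n) \prod_(i' in predC1 i)
  (g i (y ord0 i) - g i' (y ord0 i')).
have D0 : Delta z0 != 0.
  apply/prodf_neq0 => i _; apply/prodf_neq0 => i'; rewrite !inE => ii'.
  by rewrite !ga subr_eq0 inj_eq // eq_sym.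
have [||y [Uy Dy dy]] := common_nonzero_multi R n U
    (fun z => (P z)`_k - (\prod_(j < n) ('X - (g j (z ord0 j))%:P))`_k) Delta
    z z0 oU cU _ _ Uz Dz Uz0 D0.
- move=> y j x Uy Ux; apply: holB; first exact: sP.
  by apply: hol_coef_prod => i; exact: sg.
- move=> y j x Uy Ux; apply: hol_prod => i _; apply: hol_prod => i' _.
  by apply: holB; exact: sg.
move/eqP: Dy; apply; apply/eqP; rewrite subr_eq0; apply/eqP.
suff Ey : P y = \prod_(j < n) ('X - (g j (y ord0 j))%:P) by rewrite -Ey.
pose rs := [seq g i (y ord0 i) | i <- enum 'I_n].
have -> : \prod_(j < n) ('X - (g j (y ord0 j))%:P) = \prod_(t <- rs) ('X - t%:P).
  by rewrite big_map big_enum.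
have injg : injective (fun i => g i (y ord0 i)).
  move=> i i' E; apply/eqP; apply: contraNT dy => ii'.
  rewrite /Delta (bigD1 i) //= (bigD1 i') ?inE 1?eq_sym //= E subrr mul0r.
  by rewrite mul0r.
rewrite [LHS](all_roots_prod_XsubC (rs := rs)).
- by rewrite (monicP (mP _ Uy)) scale1r.
- by rewrite szP // size_map size_enum_ord.
- apply/allP => _ /mapP[i _ ->].
  by have := rootg i y _ Uy (Uy i); rewrite upd_same.
- by rewrite uniq_rootsE map_inj_uniq // enum_uniq.
Qed.

(** * Symmetrization and boundary behaviour *)

Lemma sephol_coord (R : realType) (n : nat) (U : 'I_n -> set (Cplx R))
    (f : 'rV[Cplx R]_n -> 'rV[Cplx R]_n) (i : 'I_n) :
  holomorphic (polydomain U) f -> sephol U (fun z => f z ord0 i).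
Proof.
move=> hf z j x Uz Ux; apply/holE.
have df : differentiable (fun z => f z ord0 i) (upd z j x).
  have fz := hf _ (polydomain_upd _ _ _ _ _ _ Uz Ux).
  exact: (differentiable_comp fz (differentiable_coord (f (upd z j x)) ord0 i)).
have := @diff_derivable _ _ _ _ _ (\row_k (k == j)%:R) df; rewrite /derivable.
set g1 := fun h => _; set g2 := fun h => _; suff -> : g1 = g2 by [].
apply/funext => h; rewrite /g1 /g2 /=; congr (_ *: (f _ ord0 i - _)).
apply/rowP => k; rewrite !mxE; case: eqP => [_|_].
  by [].
by rewrite mulr0 add0r.
Qed.

(** Vieta's formula, by expanding over the set J of factors that contribute their constant term.
    Coordinate k has degree [k.+1], hence the index [n - k.+1]. *)
Lemma coef_prod_symmetrization (K : comNzRingType) (n : nat) (w : 'rV[K]_n)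
    (k : 'I_n) :
  (\prod_(i < n) ('X - (w ord0 i)%:P))`_(n - k.+1) =
  (-1) ^+ k.+1 * symmetrization w ord0 k.
Proof.
have -> : \prod_(i < n) ('X - (w ord0 i)%:P) =
    \sum_(J : {set 'I_n}) (\prod_(i in J) - w ord0 i) *: 'X^(n - #|J|).
  under eq_bigr do rewrite addrC.
  rewrite bigA_distr; apply: eq_bigr => J _.
  rewrite (bigID (mem J)) /= -mul_polyC; congr (_ * _).
    rewrite rmorph_prod; apply: eq_bigr => i iJ.
    by rewrite iJ /= rmorphN.
  have -> : (n - #|J| = #|~: J|)%N.
    by have := cardsC J; rewrite card_ord; lia.
  rewrite -prodr_const; rewrite [RHS](eq_bigl (fun i => i \notin J)).
    by apply: eq_bigr => i /negbTE ->.
  by move=> i; rewrite inE.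
rewrite coef_sum mxE big_distrr /= [RHS]big_mkcond; apply: eq_bigr => J _.
rewrite coefZ coefXn.
have Jn : (#|J| <= n)%N by rewrite -[leqRHS](card_ord n) max_card.
have -> : ((n - k.+1)%N == (n - #|J|)%N) = (#|J| == k.+1).
  by have kn := ltn_ord k; apply/eqP/eqP => h; lia.
case: eqP => [E|_]; last by rewrite mulr0.
by rewrite mulr1 prodrN E.
Qed.

Lemma symmetrization_eq (K : comNzRingType) (n : nat) (w w' : 'rV[K]_n) :
  \prod_(i < n) ('X - (w ord0 i)%:P) = \prod_(i < n) ('X - (w' ord0 i)%:P) ->
  symmetrization w = symmetrization w'.
Proof.
move=> E; apply/rowP => k.
have := coef_prod_symmetrization K n w k.
rewrite E coef_prod_symmetrization => /(congr1 (fun t => (-1) ^+ k.+1 * t)).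
by rewrite !mulrA -exprD addnn -mul2n exprM sqrrN !expr1n !mul1r.
Qed.

Lemma cvg_rowP (R : realType) (n : nat) (T : Type) (F : set_system T)
    (FF : Filter F) (u : T -> 'rV[Cplx R]_n) (l : 'rV[Cplx R]_n) :
  (forall i, (fun x => u x ord0 i) @ F --> l ord0 i) -> u @ F --> l.
Proof.
move=> h A [P hP sPA].
have : \forall x \near F, forall i, P ord0 i (u x ord0 i).
  by apply: filter_forall => i; apply: (h i); exact: hP.
apply: filterS => x hx; apply: sPA => i j.
by rewrite (ord1 i); exact: hx.
Qed.

Lemma symmetrization_continuous (R : realType) (n : nat) :
  continuous (@symmetrization (Cplx R) n).
Proof.
move=> v; have NF := nbhs_filter v; apply: (cvg_rowP R n _ (nbhs v) NF) => k.
rewrite mxE (_ : (fun x => _) = fun x : 'rV[Cplx R]_n =>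
    \sum_(J : {set 'I_n} | #|J| == k.+1) \prod_(j in J) x ord0 j); last first.
  by apply/funext => x; rewrite mxE.
apply: (cvgC_sum R _ (nbhs v) NF) => J.
apply: (cvgC_prod R _ (nbhs v) NF) => j; exact: coord_continuous.
Qed.

Lemma compact_symmetrization (R : realType) (n : nat)
    (A : 'I_n -> set (Cplx R)) :
  (forall i, compact (A i)) ->
  compact (@symmetrization (Cplx R) n @` polydomain A).
Proof.
move=> cA; apply: continuous_compact; last exact: rV_compact.
exact: continuous_subspaceT (@symmetrization_continuous R n).
Qed.

(** If the images stay in a compact part of the target, the points stay in its compact preimage;
    they converge there, and the j-th coordinate of the limit is q. *)
Lemma proper_escape (R : realType) (n : nat) (U : 'I_n -> set (Cplx R))
    (E : set 'rV[Cplx R]_n) (f : 'rV[Cplx R]_n -> 'rV[Cplx R]_n)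
    (F : set_system (Cplx R)) (j : 'I_n) z q (A : set 'rV[Cplx R]_n) :
  proper_holomorphic (polydomain U) E f -> UltraFilter F ->
  polydomain U z -> F (U j) -> tends0 F (fun x => x - q) ->
  A `<=` E -> compact A -> F [set x | A (f (upd z j x))] -> U j q.
Proof.
move=> [_ _ prop] FU Uz FUj Fq AE cA FA.
have PF : ProperFilter F by exact: ultra_proper.
have FF : Filter F by exact: filter_filter.
have [|l [Ul _] hl] := ultra_compact_cvg _ _ F (upd z j) _ FU (prop A AE cA).
  by apply: filterS2 FUj FA => x Ux Ax; split=> //; exact: polydomain_upd.
have lj : id @ F --> l ord0 j.
  have -> : (id : Cplx R -> Cplx R) = (fun v : 'rV[Cplx R]_n => v ord0 j) \o upd z j.
    by apply/funext => x; rewrite /= updE eqxx.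
  exact: cvg_comp hl (@coord_continuous _ _ _ ord0 j l).
have lq : id @ F --> q by apply/cvgCP.
have -> : q = l ord0 j.
  exact: (@cvg_unique _ (@norm_hausdorff _ (Cplx R)) _ _ _ _ lq lj).
exact: Ul.
Qed.

(* If all limit roots were in V, the images would stay in a compact subset of
   the symmetrized power, against properness. *)
Lemma boundary_root (R : realType) (n : nat) (U : 'I_n -> set (Cplx R))
    (V : set (Cplx R)) (B : R) (f w : 'rV[Cplx R]_n -> 'rV[Cplx R]_n)
    (F : set_system (Cplx R)) (j : 'I_n) z q :
  proper_holomorphic (polydomain U) (symmetrized_power n V) f -> open V ->
  (forall v, V v -> cabs v <= B) ->
  (forall z, polydomain U z ->
     polydomain (fun=> V) (w z) /\ f z = symmetrization (w z)) ->
  UltraFilter F -> polydomain U z -> F (U j) -> tends0 F (fun x => x - q) ->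
  ~ U j q ->
  exists v, ~ V v /\ tends0 F (fun x =>
    (\prod_(i < n) ('X - (w (upd z j x) ord0 i)%:P)).[v]).
Proof.
move=> pf oV VB hw FU Uz FUj Fq nUq.
have PF : ProperFilter F by exact: ultra_proper.
have FF : Filter F by exact: filter_filter.
have lim_w i : exists l : Cplx R, (fun x => w (upd z j x) ord0 i) @ F --> l.
  have := ultra_compact_cvg _ _ F (fun x => w (upd z j x) ord0 i) _ FU
    (compact_disc R 0 B).
  case=> [|l _ hl]; last by exists l.
  apply: filterS FUj => x Ux /=; rewrite subr0; apply: VB.
  by have [+ _] := hw _ (polydomain_upd _ _ _ _ _ _ Uz Ux); apply.
have [l hl] := choice lim_w.
have [allV|/existsNP[i nVi]] := pselect (forall i, V (l i)).
  exfalso; apply: nUq.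
  have rad i : exists r : R, 0 < r /\ forall t, cabs (t - l i) <= r -> V t.
    have [r r0 hr] := open_discP _ _ _ oV (allV i).
    exists (r / 2); split=> [|t ht]; first by rewrite divr_gt0.
    by apply: hr; apply: le_lt_trans ht _; lra.
  have [r hr] := choice rad.
  pose A i := [set t | cabs (t - l i) <= r i].
  apply: (proper_escape R n U _ f F j z q _ pf FU Uz FUj Fq _
    (compact_symmetrization R n A _)).
  - move=> _ [v Av <-]; exists v => // i; exact: (hr i).2 (Av i).
  - by move=> i; exact: compact_disc.
  - have H : \forall x \near F, forall i, A i (w (upd z j x) ord0 i).
      apply: filter_forall => i.
      have /cvgCP/(_ (r i) (hr i).1) := hl i.
      by apply: filterS => x /= /ltW.
    apply: filterS2 FUj H => x Ux Ax /=.
    have [_ ->] := hw _ (polydomain_upd _ _ _ _ _ _ Uz Ux).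
    by exists (w (upd z j x)).
(* The value at l i is a product of differences whose limit contains the factor l i - l i. *)
exists (l i); split=> // e e0.
have /cvgCP/(_ e e0) : (fun x => \prod_(k < n) (l i - w (upd z j x) ord0 k)) @ F
    --> \prod_(k < n) (l i - l k).
  apply: cvgC_prod => k; apply: cvgB; first exact: cvg_cst.
  exact: hl.
rewrite (bigD1 i (P := xpredT)) //= subrr mul0r.
apply: filterS => x /=; rewrite subr0 horner_prod.
by under [in X in _ -> X]eq_bigr do rewrite hornerXsubC.
Qed.

Theorem theorem1p2 (R : realType) (n : nat) (hn : (2 <= n)%N)
    (U : 'I_n -> set (Cplx R))
    (domU : forall j, domain (U j)) (bndU : forall j, bounded_set (U j))
    (V : set (Cplx R)) (domV : domain V) (bndV : bounded_set V)
    (f : 'rV[Cplx R]_n -> 'rV[Cplx R]_n)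
    (hf : proper_holomorphic (polydomain U) (symmetrized_power n V) f) :
  exists g : 'I_n -> Cplx R -> Cplx R,
    (forall j, proper_holomorphic (U j) V (g j)) /\
    (forall z, polydomain U z -> f z = symmetrization (prod_map g z)).
Proof.
have oU j : open (U j) by have [] := domU j.
have cU j : connected (U j) by have [] := domU j.
have [_ oV _] := domV; have [B B0 VB] := bounded_setC _ _ bndV.
have [fU hol_f _] := hf.
have neU j : exists x, U j x by have [[x Ux] _ _] := domU j; exists x.
have [zs0 hzs] := choice neU.
pose zs : 'rV[Cplx R]_n := \row_j zs0 j.
have Uzs : polydomain U zs by move=> j; rewrite /zs mxE; exact: hzs.
(* An arbitrary, possibly discontinuous choice of n points over f(z), with default 0 outside the
   polydomain; holomorphy will be used only for the coefficients of [P]. *)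
have w_ex z : exists v, polydomain U z ->
    polydomain (fun=> V) v /\ f z = symmetrization v.
  have [Uz|nUz] := pselect (polydomain U z); last by exists 0.
  by have [v Vv fv] := fU z Uz; exists v.
have [w hw] := choice w_ex.
pose P z := \prod_(i < n) ('X - (w z ord0 i)%:P).
have wV z i : polydomain U z -> V (w z ord0 i) by move=> /hw[Vw _].
have sP k : sephol U (fun z => (P z)`_k).
  have szP z : size (P z) = n.+1.
    by rewrite size_prod_XsubC /index_enum -enumT size_enum_ord.
  have const c : (forall z, (P z)`_k = c) -> sephol U (fun z => (P z)`_k).
    move=> hc z j x _ _; apply: (hol_ext _ (fun=> c)); last exact: holC.
    by move=> y; rewrite hc.
  (* Below degree n the coefficients are, up to sign, coordinates of f, the k-th one having index
     [n - k.+1]; the others are the constants 0 and 1. *)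
  case: (ltngtP k n) => [kn|nk|kn].
  - have in_ : (n - k.+1 < n)%N by lia.
    pose i := Ordinal in_.
    apply: (sephol_ext _ _ _ (fun z => (-1) ^+ i.+1 * f z ord0 i)) => //.
      move=> z Uz; have [_ ->] := hw z Uz; rewrite -coef_prod_symmetrization.
      have ink : (n - i.+1)%N = k by rewrite /=; lia.
      by rewrite ink.
    move=> z j x Uz Ux; apply: holM; first exact: holC.
    exact: (sephol_coord R n U f i hol_f z j x Uz Ux).
  - have Pk0 z : (P z)`_k = 0 by apply: nth_default; rewrite szP; exact: nk.
    exact: (const 0 Pk0).
  - have Pk1 z : (P z)`_k = 1.
      have /monicP : P z \is monic by exact: monic_prod_XsubC.
      by rewrite lead_coefE szP kn.
    exact: (const 1 Pk1).
have [|z0 [a [Uz0 inja r1 r2 r3]]] := separated_point R n U V P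
    (fun z i => w z ord0 i) B zs oU cU bndU Uzs (ltW B0) VB (fun z _ => erefl)
    wV sP.
  move=> j F q z FU FUj Fq nUq Uz.
  exact: (boundary_root R n U V B f w F j z q hf oV VB hw FU Uz FUj Fq nUq).
have [g [gVh Pg]] := product_form R n U V P (fun z i => w z ord0 i) z0 a oU cU
  (fun z _ => erefl) wV sP Uz0 inja r1 r2 r3.
have fg z : polydomain U z -> f z = symmetrization (prod_map g z).
  move=> Uz; have [_ ->] := hw z Uz; apply: symmetrization_eq.
  rewrite -/(P z) Pg //; apply: eq_bigr => i _; by rewrite mxE.
exists g; split=> // j; split.
- by move=> x /gVh[].
- by move=> x /gVh[_ /holE/derivable1_diffP].
move=> A AV cA; rewrite compact_ultra => F FU FA.
have PF : ProperFilter F by exact: ultra_proper.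
have FF : Filter F by exact: filter_filter.
have FUj : F (U j) by apply: filterS FA => x [].
have [D D0 hD] := bounded_setC _ _ (bndU j).
have [|q _ Fq] := ultra_compact_cvg _ _ F id _ FU (compact_disc R 0 D).
  by apply: filterS FUj => y /=; rewrite subr0; exact: hD.
have Fq0 : tends0 F (fun y => y - q) by exact/cvgCP.
(* Properness of g j comes from that of f with the other coordinates frozen at [z0]: the images lie
   in the symmetrization of a product of A with single points, which is compact. *)
pose A' i := if i == j then A else [set g i (z0 ord0 i)].
have Uq : U j q.
  apply: (proper_escape R n U _ f F j z0 q _ hf FU Uz0 FUj Fq0 _
    (compact_symmetrization R n A' _)).
  - move=> _ [v Av <-]; exists v => // i; have := Av i; rewrite /A'.
    case: eqP => _; first exact: AV.
    by move=> ->; have [] := gVh i _ (Uz0 i).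
  - by move=> i; rewrite /A'; case: eqP => _ //; exact: compact_set1.
  - apply: filterS FA => x [Ux Ax] /=.
    rewrite fg; last exact: polydomain_upd.
    exists (prod_map g (upd z0 j x)) => // i; rewrite /A' mxE updE.
    by case: eqP => [->|_].
exists q; split; last exact: Fq.
split=> //.
(* Along [F] the values of g j stay in the compact set A and tend to the value at q, which therefore
   lies in A. *)
have [_ /hol_continuous cg] := gVh j q Uq.
have [|l Al gl] := ultra_compact_cvg _ _ F (g j) _ FU cA.
  by apply: filterS FA => x [].
have gq : g j @ F --> g j q by exact: cvg_comp Fq cg.
rewrite /preimage /=.
have -> : g j q = l.
  exact: (@cvg_unique _ (@norm_hausdorff _ (Cplx R)) _ _ _ _ gq gl).
exact: Al.
Qed.
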